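(* There exists $l_0$ such that for every integer $l\ge l_0$ one has $\mathrm{VAR}[L_n]=\Theta(n)$ for $n$ large enough; that is, for every integer $l\geq l_0$ there exist constants $0<a<b$ not depending on $n$ such that $an\le \mathrm{VAR}[L_n]\le bn$ for all $n$ large enough, where $L_n=|\mathrm{LCS}(X,Y)|$ is the length of the longest common subsequence of the two random strings $X,Y$ of length $n$ in the block model with parameter $l$.
   Context: Block model with parameter $l$ (a positive integer). Let $B_{X1},B_{X2},\ldots$ and $B_{Y1},B_{Y2},\ldots$ be two i.i.d. sequences, independent of each other, each variable being uniformly distributed on $\{l-1,l,l+1\}$ (each value has probability $1/3$). A block is a maximal run of equal symbols. $X^\infty=X_1X_2X_3\ldots$ is the infinite binary sequence, with symbols alternating between $0$ and $1$ from one block to the next, whose $i$-th block has length $B_{Xi}$ and whose first symbol $X_1$ is $0$ or $1$ with probability $1/2$ each. $Y^\infty=Y_1Y_2Y_3\ldots$ is defined in the same way from the $B_{Yi}$, with $Y_1$ equal to $0$ or $1$ with probability $1/2$ each; $X^\infty$ and $Y^\infty$ are independent. Put $X=X_1\ldots X_n$ and $Y=Y_1\ldots Y_n$. A longest common subsequence (LCS) of two strings is a string of maximal length that is a (not necessarily contiguous) subsequence of both; $|\mathrm{LCS}(X,Y)|$ denotes its length. *)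

(* Defs.v *)
From HB Require Import structures.
From mathcomp Require Import all_boot all_order all_algebra.
From mathcomp Require Import finmap.
From mathcomp Require Import all_classical all_reals all_analysis.

Set Implicit Arguments.
Unset Strict Implicit.
Unset Printing Implicit Defensive.

Import Order.TTheory GRing.Theory Num.Theory.

Local Open Scope classical_set_scope.
Local Open Scope ring_scope.

(* Length of a longest common subsequence: the subsequences of [x] are the     *)
(* [mask m x], where the bit sequence [m] selects positions of [x].            *)
Definition lcs_length (A : eqType) (x y : seq A) : nat :=
  (\max_(m : (size x).-tuple bool | subseq (mask m x) y) size (mask m x))%N.

Lemma lcs_length_max (A : eqType) (x y s : seq A) :
  subseq s x -> subseq s y -> (size s <= lcs_length x y)%N.
Proof.
case/subseqP=> m szm -> sy.
have mP : size m == size x by exact/eqP.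
exact: (@leq_bigmax_cond _ _ (fun m : (size x).-tuple bool => size (mask m x))
  (Tuple mP)).
Qed.

Lemma lcs_length_attained (A : eqType) (x y : seq A) :
  exists s, [/\ subseq s x, subseq s y & size s = lcs_length x y].
Proof.
have [|m my Em] := @eq_bigmax_cond _
  (fun m : (size x).-tuple bool => subseq (mask m x) y)
  (fun m : (size x).-tuple bool => size (mask m x)).
  apply/card_gt0P; exists [tuple of nseq (size x) false].
  by rewrite unfold_in /= mask_false sub0seq.
by exists (mask m x); split; [exact: mask_subseq | exact: my | rewrite -Em].
Qed.

(* Positions and blocks are numbered from 0.  The blocks [0 .. i] occupy the   *)
(* positions smaller than [block_end b i], and the block containing position   *)
(* [k] is found by counting the blocks that end at or before [k]; as blocks    *)
(* are nonempty, only the first [k] blocks can.                                *)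
Definition block_end (b : nat -> nat) (i : nat) : nat :=
  (\sum_(j < i.+1) b j)%N.

Definition block_of (b : nat -> nat) (k : nat) : nat :=
  count (fun i => block_end b i <= k)%N (iota 0 k).

Lemma block_ofP (b : nat -> nat) (k i : nat) : (forall j, 0 < b j)%N ->
  (\sum_(j < i) b j <= k < block_end b i)%N -> block_of b k = i.
Proof.
move=> b0 /andP[ik ki].
have mono p q : (p <= q)%N -> (block_end b p <= block_end b q)%N.
  move=> pq; rewrite -(subnKC pq); elim: (q - p)%N => [|r IHr].
    by rewrite addn0.
  by rewrite addnS (leq_trans IHr)// /block_end [leqRHS]big_ord_recr leq_addr.
have le_ik : (i <= k)%N.
  apply: leq_trans ik; rewrite -[leqLHS]card_ord -sum1_card.
  exact: leq_sum.
have E j : (block_end b j <= k)%N = (j < i)%N.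
  case: (ltnP j i) => [ji|ij]; last first.
    by apply/negbTE; rewrite -ltnNge (leq_trans ki)// mono.
  case: i ji ik {ki le_ik} => // i ji ik.
  exact: leq_trans (mono _ _ (ltnSE ji)) ik.
rewrite /block_of (eq_count E) -(subnKC le_ik) iotaD count_cat.
rewrite (_ : count _ (iota 0 i) = i); last first.
  rewrite -[RHS](size_iota 0); apply/eqP; rewrite -all_count.
  by apply/allP => j; rewrite mem_iota.
rewrite (_ : count _ _ = 0%N) ?addn0//; apply/eqP.
rewrite -leqn0 leqNgt -has_count -all_predC; apply/allP => j.
by rewrite mem_iota add0n => /andP[ij _] /=; rewrite -leqNgt.
Qed.

(* The symbol at position [k] of the infinite string with first symbol [s] and *)
(* successive block lengths [b 0, b 1, ...]; [true] is 1 and [false] is 0.     *)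
Definition block_symbol (s : bool) (b : nat -> nat) (k : nat) : bool :=
  s (+) odd (block_of b k).

Definition block_string (s : bool) (b : nat -> nat) (n : nat) : seq bool :=
  mkseq (block_symbol s b) n.

Section Model.
Context {d : measure_display} {T : measurableType d} {R : realType}.
Variable P : probability T R.

(* Mutual independence of a family of sub-sigma-algebras. *)
Definition mutually_independent (I : choiceType) (G : I -> set (set T)) :=
  forall (J : {fset I}) (A : I -> set T), (forall i, i \in J -> G i (A i)) ->
    P (\bigcap_(i in [set` J]) A i) = (\prod_(i <- J) P (A i))%E.

(* The sigma-algebra generated by [X]. *)
Definition sigma_RV d' (U : measurableType d') (X : {RV P >-> U}) :
  set (set T) := preimage_set_system setT X measurable.

Variables (BX BY : nat -> {RV P >-> nat}) (sX sY : {RV P >-> bool}).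

Definition model_sigma (i : (nat + nat) + bool) : set (set T) :=
  match i with
  | inl (inl j) => sigma_RV (BX j)
  | inl (inr j) => sigma_RV (BY j)
  | inr false => sigma_RV sX
  | inr true => sigma_RV sY
  end.

Definition uniform_length (l : nat) (B : {RV P >-> nat}) :=
  forall k : nat, k \in [:: l.-1; l; l.+1] ->
    P (B @^-1` [set k]) = (3%:R^-1)%:E.

Definition fair_bit (s : {RV P >-> bool}) :=
  forall c : bool, P (s @^-1` [set c]) = (2%:R^-1)%:E.

Record block_model (l : nat) : Prop := BlockModel {
  block_model_BX : forall i, uniform_length l (BX i);
  block_model_BY : forall i, uniform_length l (BY i);
  block_model_sX : fair_bit sX;
  block_model_sY : fair_bit sY;
  block_model_indep : mutually_independent model_sigma
}.

Definition lcs_RV (n : nat) (t : T) : R :=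
  (lcs_length (block_string (sX t) (BX ^~ t) n)
              (block_string (sY t) (BY ^~ t) n))%:R.

End Model.

(* Main.v *)
(* Lower bound.  By Cauchy-Schwarz, a statistic [f] of the block lengths with variance of   *)
(* order [n] gives Var(L_n) >= Cov(L_n, f)^2 / Var(f), so it suffices that Cov(L_n, f) is   *)
(* of order [n].  Pair up neighbouring blocks of X and let [f] add 2 for each pair (l, l)   *)
(* and -1 for each pair (l-1, l+1) or (l+1, l-1).  Then Cov(L_n, f) is the expected total   *)
(* change of L_n when each unequal pair is replaced by (l, l), one pair at a time; this     *)
(* replacement does not move the end of X.  If the two blocks are matched with blocks of Y  *)
(* of lengths p and q, then replacing (l-1, l+1) gains [l <= p] and loses at most           *)
(* [l+1 <= q], which is positive on average as long as the optimal alignment does not bias  *)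
(* (p, q).  Since L_n >= n - O(n/l), an optimal alignment matches all but a fraction O(1/l) *)
(* of the blocks one to one; for large l the number of such alignments is therefore         *)
(* exponentially small compared with the large deviation rate, and a union bound applies.   *)
(* It is run on an exponential moment: 2^t * 2^-D >= 1 + t - D for integers turns           *)
(* E[2^-D] <= 2^-t into E[D] >= t.                                                          *)
(*                                                                                          *)
(* Upper bound.  Changing one block length changes L_n by at most 2, and Efron-Stein gives  *)
(* Var = O(n) for fixed first symbols; changing a first symbol amounts, up to O(l), to      *)
(* prepending one block.                                                                    *)

(* By [variance_lcs] the variance of L_n is a finite average over the two first symbols and over 2n
   independent uniform block lengths, so both bounds concern finite sums.

   Lower bound. [means_sqr_ge] is the Cauchy-Schwarz step, and [means_gain] identifies the
   covariance with the mean gain D. To bound D, fix both strings and cut Y into segments, one per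
   block of X, so that the LCS is realised blockwise ([optimal_cut_exists]). With ties broken
   suitably, all but a few blocks of X receive exactly one whole block of Y ([good_blockP],
   [bad_blocks_le]). The same cut is admissible after two blocks of X are equalised, so D is at
   least a sum of local terms read off the paired lengths ([block_alignment], [gain_weight_le]). For
   a fixed pairing the local terms are independent and each pair of blocks contributes a factor
   79/81 to the mean of 2^-D ([means_pair_weight]). A pairing is coded by the blocks it skips;
   summing over all codes costs less than this decay ([means_gain_weight_le], [means_gain_lower]).

   Upper bound. [block_string_update_lcs] and [lcs_length_triangle] give bounded differences,
   [wsums_var_le] the variance for fixed first symbols, and [means_flip] the passage to the other
   first symbols. *)
Require Import Defs.
From mathcomp Require Import all_boot all_order all_algebra.
From mathcomp Require Import finmap.
From mathcomp Require Import all_classical all_reals all_analysis.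
From mathcomp Require Import measurable_realfun zify ring lra.
Import Order.TTheory GRing.Theory Num.Theory.

Set Implicit Arguments.
Unset Strict Implicit.
Unset Printing Implicit Defensive.

(** * Longest common subsequences *)

Section LCS.
Variable A : eqType.
Implicit Types x y s : seq A.

Lemma lcs_length_le x y n :
  (forall s, subseq s x -> subseq s y -> size s <= n) -> lcs_length x y <= n.
Proof. by move=> le_n; have [s [sx sy <-]] := lcs_length_attained x y; exact: le_n. Qed.

Lemma lcs_lengthC x y : lcs_length x y = lcs_length y x.
Proof.
by apply/eqP; rewrite eqn_leq; apply/andP; split; apply: lcs_length_le => s *;
  exact: lcs_length_max.
Qed.

Lemma lcs_length_size x y : lcs_length x y <= size x.
Proof. by apply: lcs_length_le => s /size_subseq. Qed.

Lemma lcs_length_subseq x x' y y' :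
  subseq x x' -> subseq y y' -> lcs_length x y <= lcs_length x' y'.
Proof.
move=> xx' yy'; apply: lcs_length_le => s sx sy.
by apply: lcs_length_max; [exact: subseq_trans xx' | exact: subseq_trans yy'].
Qed.

Lemma lcs_length_cat x1 x2 y1 y2 :
  lcs_length x1 y1 + lcs_length x2 y2 <= lcs_length (x1 ++ x2) (y1 ++ y2).
Proof.
have [s1 [sx1 sy1 <-]] := lcs_length_attained x1 y1.
have [s2 [sx2 sy2 <-]] := lcs_length_attained x2 y2.
by rewrite -size_cat; apply: lcs_length_max; apply: cat_subseq.
Qed.

Lemma subseq_cat_split s x1 x2 : subseq s (x1 ++ x2) ->
  exists s1 s2, [/\ s = s1 ++ s2, subseq s1 x1 & subseq s2 x2].
Proof.
case/subseqP => m sz_m ->; exists (mask (take (size x1) m) x1), (mask (drop (size x1) m) x2).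
split; [|exact: mask_subseq..].
rewrite -[in LHS](cat_take_drop (size x1) m) mask_cat //.
by rewrite size_take sz_m size_cat; case: ltngtP => //; lia.
Qed.

Lemma cat_subseq_split s1 s2 y : subseq (s1 ++ s2) y ->
  exists y1 y2, [/\ y = y1 ++ y2, subseq s1 y1 & subseq s2 y2].
Proof.
elim: y s1 => [|a y IH] [|b s1] //=.
- by move=> /eqP ->; exists [::], [::].
- by move=> sub; exists [::], (a :: y).
case: eqP => [<-|ab] sub.
  have [y1 [y2 [-> s1y1 s2y2]]] := IH s1 sub.
  by exists (b :: y1), y2; split; rewrite //= eqxx.
have [y1 [y2 [-> s1y1 s2y2]]] := IH (b :: s1) sub.
exists (a :: y1), y2; split => //.
exact: subseq_trans s1y1 (subseq_cons _ _).
Qed.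

Lemma lcs_length_split x1 x2 y : exists y1 y2, y = y1 ++ y2 /\
  lcs_length (x1 ++ x2) y <= lcs_length x1 y1 + lcs_length x2 y2.
Proof.
have [s [sx sy <-]] := lcs_length_attained (x1 ++ x2) y.
have [s1 [s2 [Es sx1 sx2]]] := subseq_cat_split sx; rewrite {}Es in sy *.
have [y1 [y2 [-> sy1 sy2]]] := cat_subseq_split sy.
by exists y1, y2; split; rewrite // size_cat leq_add // lcs_length_max.
Qed.

Lemma lcs_length_nseq k a y : lcs_length (nseq k a) y = minn k (count_mem a y).
Proof.
apply/eqP; rewrite eqn_leq; apply/andP; split.
  apply: lcs_length_le => s sk sy; rewrite leq_min.
  have := size_subseq sk; rewrite size_nseq => -> /=.
  have /all_pred1P Es : all (pred1 a) s.
    apply/allP => b /(mem_subseq sk); by rewrite mem_nseq => /andP[].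
  have := leq_count_subseq (pred1 a) sy; rewrite Es count_nseq /= eqxx mul1n.
  by rewrite size_nseq.
rewrite -[leqLHS](size_nseq _ a); apply: lcs_length_max.
  by rewrite -{2}(subnKC (geq_minl k (count_mem a y))) nseqD prefix_subseq.
have /all_pred1P Ef := filter_all (pred1 a) y.
apply: subseq_trans (filter_subseq (pred1 a) y); rewrite Ef size_filter.
by rewrite -{2}(subnKC (geq_minr k (count_mem a y))) nseqD prefix_subseq.
Qed.

(** Keep the positions selected by both masks and apply inclusion-exclusion to the selected
    positions. *)
Lemma mask_meet m1 m2 x : size m1 = size x -> size m2 = size x ->
  exists s, [/\ subseq s (mask m1 x), subseq s (mask m2 x)
              & size (mask m1 x) + size (mask m2 x) <= size x + size s].
Proof.
elim: x m1 m2 => [|a x IH] [|b1 m1] [|b2 m2] //=; first by exists [::].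
move=> [/IH {}IH] [/IH [s [s1 s2 le_s]]].
case: b1; case: b2 => /=.
- by exists (a :: s); rewrite /= eqxx; split; [..| lia].
- by exists s; split; [exact: subseq_trans s1 (subseq_cons _ _) | | lia].
- by exists s; split; [| exact: subseq_trans s2 (subseq_cons _ _) | lia].
- by exists s; split; [..| lia].
Qed.

(** Two subsequences of [x] overlap in at least the excess of their total size over [size x]. This
    makes the LCS with a third string Lipschitz in [x]. *)
Lemma lcs_length_triangle x x' y :
  lcs_length x y + lcs_length x x' <= size x + lcs_length x' y.
Proof.
have [s1 [/subseqP[m1 sz1 ->] sy <-]] := lcs_length_attained x y.
have [s2 [/subseqP[m2 sz2 ->] sx' <-]] := lcs_length_attained x x'.
have [s [s1' s2' le_s]] := mask_meet sz1 sz2.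
apply: leq_trans le_s _; rewrite leq_add2l; apply: lcs_length_max.
  exact: subseq_trans s2' sx'.
exact: subseq_trans s1' sy.
Qed.

End LCS.

(** * Block strings *)

Section Blocks.
Implicit Types (b : nat -> nat) (s : bool).

Definition block_start b i := \sum_(j < i) b j.

Lemma block_startS b i : block_start b i.+1 = block_start b i + b i.
Proof. by rewrite /block_start big_ord_recr. Qed.

Lemma block_start0 b : block_start b 0 = 0.
Proof. by rewrite /block_start big_ord0. Qed.

Lemma block_start_recl b i :
  block_start b i.+1 = b 0 + block_start (fun j => b j.+1) i.
Proof. by rewrite /block_start big_ord_recl. Qed.

Lemma leq_block_start b i j : i <= j -> block_start b i <= block_start b j.
Proof.
move=> /subnKC <-; elim: (j - i) => [|k IH]; first by rewrite addn0.
by rewrite addnS block_startS (leq_trans IH) ?leq_addr.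
Qed.

Lemma block_start_lb b a k : (forall i, a <= b i) -> k * a <= block_start b k.
Proof.
move=> ba; elim: k => // k IH; rewrite block_startS mulSn addnC.
by rewrite leq_add.
Qed.

Lemma block_start_ub b a k : (forall i, b i <= a) -> block_start b k <= k * a.
Proof.
move=> ba; elim: k => [|k IH]; first by rewrite block_start0.
by rewrite block_startS mulSn addnC leq_add.
Qed.

Lemma block_of_bounds b k : (forall j, 0 < b j) ->
  block_start b (block_of b k) <= k < block_start b (block_of b k).+1.
Proof.
move=> b0; have ex : exists i, k < block_start b i.+1.
  by exists k; apply: leq_trans (block_start_lb k.+1 b0); rewrite muln1.
have [i ki min_i] := ex_minnP ex.
suff ik : block_start b i <= k by rewrite (@block_ofP b k i b0) // /block_end ik.
case: i ki min_i => [|i] _ min_i; first by rewrite block_start0.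
by rewrite leqNgt; apply/negP => /min_i; rewrite ltnn.
Qed.

Lemma block_of_eq b k i : (forall j, 0 < b j) ->
  block_start b i <= k < block_start b i.+1 -> block_of b k = i.
Proof. by move=> b0 ik; exact: block_ofP. Qed.

Lemma block_of_startE b i : (forall j, 0 < b j) -> block_of b (block_start b i) = i.
Proof.
by move=> b0; apply: block_of_eq => //; rewrite leqnn block_startS -addn1 leq_add2l b0.
Qed.

Lemma block_symbol_change b s k : (forall j, 0 < b j) ->
  block_symbol s b k.+1 != block_symbol s b k ->
  k.+1 = block_start b (block_of b k.+1).
Proof.
move=> b0; rewrite /block_symbol => neq.
have /andP[le1 gt1] := block_of_bounds k b0.
have [lt|ge] := ltnP k.+1 (block_start b (block_of b k).+1).
  by move: neq; rewrite (@block_of_eq b k.+1 (block_of b k)) ?eqxx // (leqW le1).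
have E : k.+1 = block_start b (block_of b k).+1 by apply/eqP; rewrite eqn_leq gt1 ge.
by rewrite [in RHS]E block_of_startE.
Qed.

Lemma block_string_cons b s n : (forall j, 0 < b j) ->
  block_string s b (b 0 + n) =
  nseq (b 0) s ++ block_string (~~ s) (fun i => b i.+1) n.
Proof.
move=> b0; apply: (@eq_from_nth _ false) => [|k].
  by rewrite size_cat !size_mkseq size_nseq.
rewrite size_mkseq => kn; rewrite nth_mkseq // nth_cat size_nseq /block_symbol.
case: ltnP => [lt|ge].
  rewrite nth_nseq lt (@block_of_eq b k 0) ?addbF //.
  by rewrite block_start0 block_startS block_start0 lt.
rewrite nth_mkseq; last by lia.
have b0' j : 0 < b j.+1 by [].
have := block_of_bounds (k - b 0) b0'; set i := block_of _ (k - b 0) => ik.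
rewrite (@block_of_eq b k i.+1) //=; first by rewrite /block_symbol -/i; case: (s); case: (odd i).
by rewrite !(block_start_recl b); lia.
Qed.

Lemma block_string_short b s n : (forall j, 0 < b j) -> n <= b 0 ->
  block_string s b n = nseq n s.
Proof.
move=> b0 nb; apply: (@eq_from_nth _ false) => [|k]; first by rewrite size_mkseq size_nseq.
rewrite size_mkseq => kn; rewrite nth_mkseq // nth_nseq kn /block_symbol.
rewrite (@block_of_eq b k 0) ?addbF //.
by rewrite block_start0 block_startS block_start0 (leq_trans kn).
Qed.

Lemma block_string_ext b b' s n : (forall i, i < n -> b i = b' i) ->
  block_string s b n = block_string s b' n.
Proof.
move=> bb'; apply/eq_in_map => k; rewrite mem_iota => /andP[_ kn].
congr (_ (+) odd _); apply/eq_in_count => i; rewrite mem_iota => /andP[_ ik].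
congr (_ <= _); apply: eq_bigr => j _; apply: bb'.
by apply: leq_trans (ltn_ord j) _; lia.
Qed.

Lemma size_block_string b s n : size (block_string s b n) = n.
Proof. exact: size_mkseq. Qed.

Lemma prefix_block_string b s n n' : n <= n' ->
  prefix (block_string s b n) (block_string s b n').
Proof.
by move=> /subnKC <-; rewrite /block_string /mkseq iotaD map_cat prefix_prefix.
Qed.

Definition block_prefix b s m :=
  flatten [seq nseq (b i) (s (+) odd i) | i <- iota 0 m].

Lemma block_prefixS b s m :
  block_prefix b s m.+1 = block_prefix b s m ++ nseq (b m) (s (+) odd m).
Proof. by rewrite /block_prefix -addn1 iotaD map_cat flatten_cat /= cats0. Qed.

Lemma block_stringE b s m r : (forall j, 0 < b j) ->
  block_string s b (block_start b m + r) =
  block_prefix b s m ++ block_string (s (+) odd m) (fun i => b (m + i)) r.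
Proof.
elim: m r => [|m IH] r b0; first by rewrite block_start0 addbF.
rewrite block_startS -addnA IH // block_prefixS -catA; congr (_ ++ _).
have := @block_string_cons (fun i => b (m + i)) (s (+) odd m) r (fun j => b0 _).
rewrite addn0 => ->; congr (_ ++ _); rewrite /= addbN.
by apply: block_string_ext => i _; rewrite addnS.
Qed.

(** Match blocks of equal index: they carry the same symbol and share at least [l.-1] copies of
    it. *)
Lemma block_string_diag l b b' s n n' k : 0 < l.-1 ->
  (forall i, l.-1 <= b i <= l.+1) -> (forall i, l.-1 <= b' i <= l.+1) ->
  k * l.+1 <= n -> k * l.+1 <= n' ->
  k * l.-1 <= lcs_length (block_string s b n) (block_string s b' n').
Proof.
move=> l0 bl bl'; have b0 j : 0 < b j by have := bl j; lia.
have b0' j : 0 < b' j by have := bl' j; lia.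
elim: k b b' s n n' bl bl' b0 b0' => // k IH b b' s n n' bl bl' b0 b0' kn kn'.
have := bl 0; have := bl' 0 => B0 B0'.
have -> : n = b 0 + (n - b 0) by rewrite mulSn in kn; lia.
have -> : n' = b' 0 + (n' - b' 0) by rewrite mulSn in kn'; lia.
rewrite !block_string_cons //.
apply: leq_trans (lcs_length_cat _ _ _ _).
rewrite lcs_length_nseq count_nseq /= eqxx mul1n mulSn leq_add //; first by lia.
by apply: IH => //; [move: kn | move: kn']; rewrite mulSn; lia.
Qed.

(* If the first symbols differ, drop the first block of one of the strings. *)
Lemma block_string_lcs_lb l b b' s s' n k : 0 < l.-1 ->
  (forall i, l.-1 <= b i <= l.+1) -> (forall i, l.-1 <= b' i <= l.+1) ->
  k.+1 * l.+1 <= n ->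
  k * l.-1 <= lcs_length (block_string s b n) (block_string s' b' n).
Proof.
move=> l0 bl bl' kn.
case: (eqVneq s s') => [->|neq].
  by apply: block_string_diag => //; rewrite mulSn in kn; lia.
have -> : s' = ~~ s by move: s s' neq => [] [].
have := bl 0 => B0; rewrite mulSn in kn.
have b0 j : 0 < b j by have := bl j; lia.
have -> : block_string s b n = block_string s b (b 0 + (n - b 0)).
  by congr (block_string _ _ _); lia.
rewrite block_string_cons //.
apply: (@leq_trans (lcs_length (block_string (~~ s) (fun i => b i.+1) (n - b 0))
   (block_string (~~ s) b' n))).
  by apply: block_string_diag => //; lia.
by apply: lcs_length_subseq => //; exact: suffix_subseq.
Qed.

Lemma common_prefix_lcs (A : eqType) (u v w : seq A) :
  prefix u v -> prefix u w -> size u <= lcs_length v w.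
Proof. by move=> /prefixP[v1 ->] /prefixP[w1 ->]; apply: lcs_length_max; exact: prefix_subseq. Qed.

(** Lengthening block [i] pushes at most [e] symbols past position [n]; everything else can be
    matched. The induction strips the equal blocks in front of block [i]. *)
Lemma block_string_update_lcs b b' s n i e :
  (forall j, 0 < b j) -> (forall j, 0 < b' j) ->
  (forall j, j != i -> b j = b' j) -> b i <= b' i <= b i + e ->
  n <= lcs_length (block_string s b n) (block_string s b' n) + e.
Proof.
move=> b0 b0'; elim: i b b' s n b0 b0' => [|i IH] b b' s n b0 b0' bb' be.
  case: (leqP n (b 0)) => [nb|/ltnW/subnKC En].
    rewrite !block_string_short //; last by lia.
    rewrite -{1}(size_nseq n s); apply: leq_trans (leq_addr _ _).
    exact: lcs_length_max.
  rewrite -En (@block_string_cons b) //; set r := n - b 0.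
  case: (leqP n (b' 0)) => [nb|/ltnW/subnKC En'].
    rewrite {2}En (@block_string_short b') //.
    have : size (nseq (b 0) s) <= lcs_length
      (nseq (b 0) s ++ block_string (~~ s) (fun j => b j.+1) r) (nseq n s).
      apply: lcs_length_max; first exact: prefix_subseq.
      by rewrite -En nseqD prefix_subseq.
    by rewrite size_nseq; lia.
  rewrite {2}En -{1}En' (@block_string_cons b') //.
  have := lcs_length_cat (nseq (b 0) s) (block_string (~~ s) (fun j => b j.+1) r)
     (nseq (b' 0) s) (block_string (~~ s) (fun j => b' j.+1) (n - b' 0)).
  rewrite lcs_length_nseq count_nseq /= eqxx mul1n.
  suff : n - b' 0 <= lcs_length (block_string (~~ s) (fun j => b j.+1) r)
     (block_string (~~ s) (fun j => b' j.+1) (n - b' 0)) by lia.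
  rewrite (@block_string_ext (fun j => b j.+1) (fun j => b' j.+1)); last first.
    by move=> j _; exact: bb'.
  rewrite -{1}(size_block_string (fun j => b' j.+1) (~~ s) (n - b' 0)).
  apply: common_prefix_lcs; last exact: prefix_refl.
  by apply: prefix_block_string; rewrite /r; lia.
have E0 : b 0 = b' 0 by exact: bb'.
case: (leqP n (b 0)) => [nb|/ltnW/subnKC En].
  rewrite !block_string_short -?E0 //.
  rewrite -{1}(size_nseq n s); apply: leq_trans (leq_addr _ _).
  exact: lcs_length_max.
have Eb' := @block_string_cons b' s (n - b 0) b0'; rewrite -E0 in Eb'.
rewrite -En (@block_string_cons b) // Eb'.
apply: leq_trans (leq_add (lcs_length_cat _ _ _ _) (leqnn e)).
rewrite lcs_length_nseq count_nseq /= eqxx mul1n minnn -addnA leq_add2l.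
by apply: IH => // j ji; exact: bb'.
Qed.

End Blocks.

(** * Cutting one string along the blocks of the other *)

Section Cuts.
Variables (s : bool) (Y : seq bool).
Implicit Types (b t : nat -> nat) (Q : seq bool) (m : nat).

Local Notation color i := (s (+) odd i).

Definition symbols d u v := \sum_(u <= p < v) (nth false Y p == d).

Lemma symbols_count d u v : u <= v <= size Y ->
  symbols d u v = count_mem d (take (v - u) (drop u Y)).
Proof.
move=> /andP[uv vY]; rewrite -sum1_count big_mkcond (big_nth false).
rewrite size_take size_drop.
have -> : (if v - u < size Y - u then v - u else size Y - u) = v - u by case: ifP; lia.
rewrite /symbols -{1}(add0n u) big_addn; apply: eq_big_nat => i /andP[_ iuv].
by rewrite nth_take // nth_drop addnC /=; case: (_ == d).
Qed.

Lemma symbolsC d u v : u <= v -> symbols d u v + symbols (~~ d) u v = v - u.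
Proof.
move=> uv; rewrite /symbols -big_split /= -[RHS]muln1 -sum_nat_const_nat.
by apply: eq_bigr => i _; case: d; case: nth.
Qed.

Lemma symbols_cat d u v w : u <= v <= w -> symbols d u w = symbols d u v + symbols d v w.
Proof. by move=> /andP[uv vw]; rewrite /symbols (big_cat_nat uv). Qed.

Lemma symbols1 d u : symbols d u u.+1 = (nth false Y u == d).
Proof. by rewrite /symbols big_nat1. Qed.

Lemma symbols_le d u v : symbols d u v <= v - u.
Proof.
rewrite /symbols -[leqRHS]muln1 -sum_nat_const_nat.
by apply: leq_sum => i _; case: eqP.
Qed.

(** The positions of [Y] from [t i] up to but excluding [t i.+1] are assigned to block [i] of X;
    those from [t m] on are left to the tail [Q]. *)
Definition is_cut m t :=
  [/\ t 0 = 0, forall i, i < m -> t i <= t i.+1 & t m <= size Y].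

Definition captured b m t :=
  \sum_(i < m) minn (b i) (symbols (color i) (t i) (t i.+1)).

Definition cut_score b m Q t := captured b m t + lcs_length Q (drop (t m) Y).

Lemma is_cutW m t : is_cut m.+1 t -> is_cut m t.
Proof.
case=> t0 tS tm; split=> // [i im|]; first by apply: tS; lia.
exact: leq_trans (tS _ (ltnSn m)) tm.
Qed.

Lemma capturedS b m t :
  captured b m.+1 t = captured b m t + minn (b m) (symbols (color m) (t m) (t m.+1)).
Proof. by rewrite /captured big_ord_recr. Qed.

(** With [cut_exists], this makes the LCS the maximum of [cut_score] over cuts. *)
Lemma cut_score_le b m Q t : is_cut m t ->
  cut_score b m Q t <= lcs_length (block_prefix b s m ++ Q) Y.
Proof.
elim: m Q => [|m IH] Q cut_t.
  by case: cut_t => t0 _ _; rewrite /cut_score /captured big_ord0 add0n t0 drop0.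
rewrite block_prefixS -catA; apply: leq_trans (IH _ (is_cutW cut_t)).
case: cut_t => _ /(_ m (ltnSn m)) tm tY.
rewrite /cut_score capturedS -addnA leq_add2l.
rewrite symbols_count ?tm // -lcs_length_nseq.
rewrite -{2}(cat_take_drop (t m.+1 - t m) (drop (t m) Y)) drop_drop (subnK tm).
exact: lcs_length_cat.
Qed.

Lemma cut_exists b m Q : exists2 t, is_cut m t &
  lcs_length (block_prefix b s m ++ Q) Y <= cut_score b m Q t.
Proof.
elim: m Q => [|m IH] Q.
  exists (fun=> 0); first by split.
  by rewrite /cut_score /captured big_ord0 add0n drop0.
rewrite block_prefixS -catA; have [t [t0 tS tm] le_t] := IH (nseq (b m) (color m) ++ Q).
have [y1 [y2 [Ey le_y]]] := lcs_length_split (nseq (b m) (color m)) Q (drop (t m) Y).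
pose t' i := if i <= m then t i else t m + size y1.
have sy : t m + size y1 <= size Y.
  by rewrite -leq_subRL // -size_drop Ey size_cat leq_addr.
have cut_t' : is_cut m.+1 t'.
  rewrite /t'; split=> [|i im|]; rewrite ?leq0n ?ltnn //.
  case: (ltnP i m) => [im'|mi]; first by rewrite (ltnW im') tS.
  by have -> : i = m by [lia]; rewrite leqnn leq_addr.
exists t' => //; apply: leq_trans le_t _.
have Ec : captured b m t = captured b m t'.
  apply: eq_bigr => i _; rewrite /t' (ltnW (ltn_ord i)) (ltn_ord i) //.
rewrite /cut_score capturedS -Ec -addnA leq_add2l.
have -> : t' m = t m by rewrite /t' leqnn.
have -> : t' m.+1 = t m + size y1 by rewrite /t' ltnn.
rewrite symbols_count ?leq_addr // addKn [t m + _]addnC -drop_drop.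
apply: leq_trans le_y _.
by rewrite Ey take_size_cat // drop_size_cat // -lcs_length_nseq.
Qed.

(** Tie-breaker among optimal cuts: unlike [captured], it is not truncated at the block lengths. *)
Definition total_symbols m t := \sum_(i < m) symbols (color i) (t i) (t i.+1).

Lemma total_symbols_le m t : is_cut m t -> total_symbols m t <= size Y.
Proof.
move=> cut_t; suff le : total_symbols m t <= t m by case: cut_t => _ _; exact: leq_trans.
elim: m cut_t => [|m IH] cut_t; first by rewrite /total_symbols big_ord0.
rewrite /total_symbols big_ord_recr /= -/(total_symbols m t).
case: (cut_t) => _ /(_ m (ltnSn m)) tm _.
by apply: leq_trans (leq_add (IH (is_cutW cut_t)) (symbols_le _ _ _)) _; rewrite subnKC.
Qed.

(* Among the optimal cuts, take one assigning as many symbols as possible to   *)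
(* blocks of their own colour; it then cuts [Y] at changes of symbol.          *)
Lemma optimal_cut_exists b m Q : exists t, [/\ is_cut m t,
  lcs_length (block_prefix b s m ++ Q) Y <= cut_score b m Q t &
  forall t', is_cut m t' -> cut_score b m Q t <= cut_score b m Q t' ->
    total_symbols m t' <= total_symbols m t].
Proof.
set L := lcs_length _ _.
pose P k := `[< exists t, [/\ is_cut m t, L <= cut_score b m Q t & total_symbols m t = k] >].
have exP : exists k, P k.
  have [t cut_t le_t] := cut_exists b m Q.
  by exists (total_symbols m t); apply/asboolP; exists t.
have ubP k : P k -> k <= size Y.
  by move=> /asboolP[t [cut_t _ <-]]; exact: total_symbols_le.
have [k /asboolP[t [cut_t le_t Ek]] max_k] := ex_maxnP exP ubP.
exists t; split=> // t' cut_t' le_t'; rewrite Ek; apply: max_k; apply/asboolP.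
by exists t'; split=> //; exact: leq_trans le_t'.
Qed.

End Cuts.

(** * Optimal cuts follow the block boundaries of Y *)

Section OptimalCut.
Variables (s s' : bool) (b y : nat -> nat) (m n a : nat) (Q : seq bool) (t : nat -> nat).
Local Notation Y := (block_string s' y n).
Local Notation color i := (s (+) odd i).
Hypothesis y0 : forall j, 0 < y j.
Hypothesis ya : forall j, a <= y j.
Hypothesis ba : forall j, a <= b j.
Hypothesis cut_t : is_cut Y m t.
Hypothesis score_t : lcs_length (block_prefix b s m ++ Q) Y <= cut_score s Y b m Q t.
Hypothesis max_t : forall t', is_cut Y m t' ->
  cut_score s Y b m Q t <= cut_score s Y b m Q t' ->
  total_symbols s Y m t' <= total_symbols s Y m t.

Let N u i := symbols Y (color i) (u i) (u i.+1).

(** [captured] is monotone in the counts [N], so [t'] would score as well as [t] with a larger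
    total, against [max_t]. *)
Lemma optimal_cut_no_gain t' i : is_cut Y m t' -> t' m = t m -> i < m ->
  (forall j, j < m -> N t j <= N t' j) -> N t i < N t' i -> False.
Proof.
move=> cut_t' tm im le_N lt_N.
have score_le : cut_score s Y b m Q t <= cut_score s Y b m Q t'.
  rewrite /cut_score tm leq_add2r; apply: leq_sum => j _.
  have := le_N j (ltn_ord j); rewrite /N; lia.
have := max_t cut_t' score_le; apply/negP; rewrite -ltnNge /total_symbols.
rewrite (bigD1 (Ordinal im)) //= [ltnRHS](bigD1 (Ordinal im)) //= -addSn.
by apply: leq_add => //; apply: leq_sum => j _; exact: le_N.
Qed.

Lemma cut_leq i j : i <= j <= m -> t i <= t j.
Proof.
case/andP=> /subnKC <-; elim: (j - i) => [|k IH]; first by rewrite addn0.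
rewrite addnS => ikm; apply: leq_trans (IH (ltnW ikm)) _.
by case: cut_t => _ /(_ _ ikm).
Qed.

Lemma cut_leq_size i : i <= m -> t i <= n.
Proof.
move=> im; case: cut_t => _ _; rewrite size_block_string; apply: leq_trans.
by apply: cut_leq; rewrite im leqnn.
Qed.

Let move_cut i v j := if j == i.+1 then v else t j.

Let move_cut_is_cut i v : i.+1 < m -> t i <= v <= t i.+2 -> is_cut Y m (move_cut i v).
Proof.
move=> im /andP[lev gev]; have [t0 tS tm] := cut_t; split=> [//|j jm|].
  rewrite /move_cut eqSS; case: (eqVneq j i.+1) => [->|_].
    by case: eqP => [|_]; [lia | exact: gev].
  case: (eqVneq j i) => [->|_]; first exact: lev.
  exact: tS.
by rewrite /move_cut; case: eqP => [|_]; [lia | ].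
Qed.

(** Otherwise shift the cut one position to the right: block [i] gains a symbol of its colour, and
    block [i.+1], of the other colour, loses none. *)
Lemma cut_right_symbol i : i.+1 < m -> t i.+1 < t i.+2 ->
  nth false Y (t i.+1) != color i.
Proof.
move=> im lt_t; apply/negP => /eqP Ec.
have ti : t i <= t i.+1 by apply: cut_leq; lia.
have N_eq k : k != i -> k != i.+1 -> N t k = N (move_cut i (t i.+1).+1) k.
  move=> /negbTE ki /negbTE ki1; rewrite /N /move_cut eqSS ki ki1 //.
have N_i : N t i < N (move_cut i (t i.+1).+1) i.
  rewrite /N /move_cut eqxx (_ : (i == i.+1) = false); last by apply/eqP; lia.
  by rewrite [ltnRHS](@symbols_cat _ _ (t i) (t i.+1)) ?ti ?leqnSn // symbols1 Ec eqxx addn1.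
apply: (@optimal_cut_no_gain (move_cut i (t i.+1).+1) i) => //.
- by apply: move_cut_is_cut => //; lia.
- by rewrite /move_cut; case: eqP => [|//]; lia.
- by lia.
move=> j jm; case: (eqVneq j i) => [->|ji]; first exact: ltnW.
case: (eqVneq j i.+1) => [->|ji1]; last by rewrite N_eq.
rewrite /N /move_cut eqxx eqSS (_ : (i.+1 == i) = false); last by apply/eqP; lia.
rewrite [leqLHS](@symbols_cat _ _ (t i.+1) (t i.+1).+1) ?leqnSn //.
by rewrite symbols1 Ec /=; case: (s); case: (odd i).
Qed.

Lemma cut_left_symbol i : i.+1 < m -> t i < t i.+1 ->
  nth false Y (t i.+1).-1 != color i.+1.
Proof.
move=> im lt_t; apply/negP => /eqP Ec.
have ti : t i.+1 <= t i.+2 by apply: cut_leq; lia.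
have Et : t i.+1 = (t i.+1).-1.+1 by lia.
set v := (t i.+1).-1 in Ec Et *.
have N_eq k : k != i -> k != i.+1 -> N t k = N (move_cut i v) k.
  move=> /negbTE ki /negbTE ki1; rewrite /N /move_cut eqSS ki ki1 //.
have N_i : N t i.+1 < N (move_cut i v) i.+1.
  rewrite /N /move_cut eqxx eqSS (_ : (i.+1 == i) = false); last by apply/eqP; lia.
  rewrite [ltnRHS](@symbols_cat _ _ v v.+1); last by rewrite leqnSn -Et.
  by rewrite symbols1 Ec eqxx -Et.
apply: (@optimal_cut_no_gain (move_cut i v) i.+1) => //.
- by apply: move_cut_is_cut => //; lia.
- by rewrite /move_cut; case: eqP => [|//]; lia.
move=> j jm; case: (eqVneq j i.+1) => [->|ji1]; first exact: ltnW.
case: (eqVneq j i) => [->|ji]; last by rewrite N_eq.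
rewrite /N /move_cut eqxx (_ : (i == i.+1) = false); last by apply/eqP; lia.
rewrite {1}Et [leqLHS](@symbols_cat _ _ (t i) v); last by lia.
by rewrite symbols1 Ec /=; case: (s); case: (odd i); rewrite addn0.
Qed.

(** With only two colours, the symbol before the cut has the colour of block [i] and the one after
    it that of block [i.+1], so a block of Y starts at the cut. *)
Lemma cut_boundary i : i.+1 < m -> t i < t i.+1 -> t i.+1 < t i.+2 ->
  t i.+1 = block_start y (block_of y (t i.+1)) /\
  block_symbol s' y (t i.+1) = color i.+1.
Proof.
move=> im lt1 lt2; have tn : t i.+2 <= n by apply: cut_leq_size; lia.
have := cut_right_symbol im lt2; have := cut_left_symbol im lt1.
rewrite !nth_mkseq; [|lia..].
have -> : t i.+1 = (t i.+1).-1.+1 by lia.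
set v := (t i.+1).-1 => /= neqL neqR; split.
  apply: (@block_symbol_change _ s') => //; apply/eqP => E; move: neqL neqR.
  by rewrite E; case: (s); case: (odd i); case: block_symbol.
by move: neqR; case: (s); case: (odd i); case: block_symbol.
Qed.

Lemma symbols_block d j : block_start y j.+1 <= n ->
  symbols Y d (block_start y j) (block_start y j.+1) =
  (s' (+) odd j == d) * y j.
Proof.
move=> jn; rewrite /symbols -[in RHS](addKn (block_start y j) (y j)) -block_startS.
rewrite mulnC -sum_nat_const_nat; apply: eq_big_nat => p /andP[jp pj].
rewrite nth_mkseq; last exact: leq_trans jn.
by rewrite /block_symbol (@block_of_eq _ p j) // jp.
Qed.

(** The threshold [a] is a lower bound for block lengths, so a segment containing a whole block of
    the wrong colour is wasteful. *)
Definition wasteful i := a <= symbols Y (~~ color i) (t i) (t i.+1).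

Definition good_block i :=
  [&& 0 < i, i.+1 < m, t i.-1 < t i, t i < t i.+1, t i.+1 < t i.+2 & ~~ wasteful i].

(** Both ends of the segment are block boundaries of Y. If it covered several blocks, it would
    contain the second one entirely, which has the wrong colour and length at least [a]. *)
Lemma good_blockP i : good_block i ->
  [/\ t i = block_start y (block_of y (t i)),
      t i.+1 = block_start y (block_of y (t i)).+1 &
      symbols Y (color i) (t i) (t i.+1) = y (block_of y (t i))].
Proof.
case: i => // i /and5P[_ im lt0 lt1 /andP[lt2]]; rewrite /wasteful -ltnNge /= in lt0 *.
have tn : t i.+3 <= n by apply: cut_leq_size.
have [Ej Cj] := cut_boundary (ltnW im) lt0 lt1.
have [Ek Ck] := cut_boundary im lt1 lt2.
set j := block_of y (t i.+1) in Ej *; set k := block_of y (t i.+2) in Ek *.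
have jk : j < k.
  by rewrite ltnNge; apply/negP => /(leq_block_start y); rewrite -Ej -Ek; lia.
have Cj' : s' (+) odd j = color i.+1 by rewrite -Cj.
case: (ltnP j.+1 k) => [jk1|kj] lt_a; last first.
  have Ek' : k = j.+1 by lia.
  split=> //; first by rewrite -Ek'.
  rewrite Ek Ek' {1}Ej symbols_block ?Cj' ?eqxx ?mul1n //.
  by rewrite -Ek' -Ek; lia.
suff : y j.+1 <= symbols Y (~~ color i.+1) (t i.+1) (t i.+2).
  by have := ya j.+1; move: lt_a => /=; lia.
have le2 : block_start y j.+2 <= t i.+2 by rewrite Ek; exact: leq_block_start.
have le1 : block_start y j.+1 <= block_start y j.+2 by exact: leq_block_start.
have le0 : t i.+1 <= block_start y j.+1 by rewrite Ej; exact: leq_block_start.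
rewrite (@symbols_cat _ _ _ (block_start y j.+1)) ?le0 ?(leq_trans le1) //.
rewrite (@symbols_cat _ _ (block_start y j.+1) (block_start y j.+2)) ?le1 ?le2 //.
rewrite symbols_block; last by lia.
have -> : s' (+) odd j.+1 = ~~ color i.+1 by rewrite -Cj' /= addbN.
by rewrite eqxx mul1n; lia.
Qed.

Let L := lcs_length (block_prefix b s m ++ Q) Y.

(** Each empty segment leaves a whole block of X, of length at least [a], unmatched. *)
Lemma empty_segments_le :
  L + a * (\sum_(i < m) (t i == t i.+1)) <= block_start b m + size Q.
Proof.
have le_m : captured s Y b m t + a * (\sum_(i < m) (t i == t i.+1)) <= block_start b m.
  rewrite big_distrr -big_split /=; apply: leq_sum => i _.
  case: eqP => [->|_]; last by rewrite muln0 addn0 geq_minl.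
  by rewrite /symbols big_geq // minn0 muln1 ba.
apply: leq_trans (leq_add score_t (leqnn _)) _.
by rewrite /cut_score addnAC; apply: leq_add le_m (lcs_length_size _ _).
Qed.

(** Each wasteful segment leaves at least [a] symbols of Y unmatched. *)
Lemma wasteful_segments_le : L + a * (\sum_(i < m) wasteful i) <= n.
Proof.
have le_m : captured s Y b m t + a * (\sum_(i < m) wasteful i) <= t m.
  have -> : t m = \sum_(i < m) (t i.+1 - t i).
    rewrite -(big_mkord xpredT (fun i => t i.+1 - t i)) telescope_sumn_in //.
      by case: cut_t => -> _ _; rewrite subn0.
    by move=> i /= im; case: cut_t => _ /(_ i im).
  rewrite big_distrr -big_split /=; apply: leq_sum => i _.
  have ti : t i <= t i.+1 by case: cut_t => _ /(_ i (ltn_ord i)).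
  rewrite -(symbolsC Y (color i) ti) leq_add ?geq_minr //.
  by rewrite /wasteful; case: (leqP a) => h /=; rewrite ?muln1 ?muln0.
apply: leq_trans (leq_add score_t (leqnn _)) _.
rewrite /cut_score addnAC; apply: (@leq_trans (t m + (n - t m))); last first.
  by rewrite subnKC ?cut_leq_size.
apply: leq_add le_m _; rewrite lcs_lengthC; apply: leq_trans (lcs_length_size _ _) _.
by rewrite size_drop size_block_string.
Qed.

(** A bad block is the first or the last one, or has an empty segment at itself or at a neighbour
    (at most [3 * e] blocks), or is wasteful (at most [e]). *)
Lemma bad_blocks_le e : L + a * e.+1 > block_start b m + size Q -> L + a * e.+1 > n ->
  \sum_(i < m) ~~ good_block i <= 2 + 4 * e.
Proof.
move=> gt_e gt_e'.
have le_emp : \sum_(i < m) (t i == t i.+1) <= e.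
  rewrite leqNgt; apply/negP => /(leq_mul (leqnn a)).
  by have := empty_segments_le; lia.
have le_was : \sum_(i < m) wasteful i <= e.
  rewrite leqNgt; apply/negP => /(leq_mul (leqnn a)).
  by have := wasteful_segments_le; lia.
pose E i := (t i == t i.+1) : nat.
(* The value 1 accounts for the first block, which has no predecessor. *)
pose Ep i := if i is i'.+1 then E i' else 1.
have le_prev : \sum_(i < m) Ep i <= e.+1.
  case: (m) le_emp => [|m'] le_emp; first by rewrite big_ord0.
  rewrite big_ord_recl /= add1n ltnS; apply: leq_trans le_emp.
  by rewrite big_ord_recr leq_addr.
have le_next : \sum_(i < m) (if i.+1 < m then E i.+1 else 1) <= e.+1.
  case: (m) le_emp => [|m'] le_emp; first by rewrite big_ord0.
  rewrite big_ord_recr /= ltnn addn1 ltnS; apply: leq_trans le_emp.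
  rewrite big_ord_recl; apply: leq_trans (leq_addl _ _); apply: leq_sum => i _.
  by rewrite ltnS ltn_ord.
apply: (@leq_trans (\sum_(i < m) (Ep i +
   (if i.+1 < m then E i.+1 else 1) + (E i + wasteful i)))); last first.
  rewrite !big_split /=.
  by apply: leq_trans (leq_add (leq_add le_prev le_next) (leq_add le_emp le_was)) _; lia.
apply: leq_sum => i _.
have tS j : j < m -> t j <= t j.+1 by case: cut_t => _ /(_ j).
have lt_i := tS i (ltn_ord i); have im := ltn_ord i.
rewrite /good_block /Ep /E; case: (wasteful i) => /=; first by rewrite andbF; lia.
case: (nat_of_ord i) lt_i im => [|j] lt_i im; first by lia.
have := tS j (ltnW im); have := tS j.+2.
by case: (ltnP j.+2 m) => /=; lia.
Qed.

End OptimalCut.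

(** * Alignments of blocks *)

Definition upd (T : Type) (x : nat -> T) i v := fun j => if j == i then v else x j.

Definition block_lcs s s' n (x y : nat -> nat) :=
  lcs_length (block_string s x n) (block_string s' y n).

Lemma sum_change2 m (f f' : nat -> nat) i j : i != j -> i < m -> j < m ->
  (forall k, k != i -> k != j -> f k = f' k) ->
  \sum_(k < m) f k + (f' i + f' j) = \sum_(k < m) f' k + (f i + f j).
Proof.
move=> ij im jm ff'.
have dec (g : nat -> nat) : \sum_(k < m) g k =
    g i + (g j + \sum_(k < m | (k != Ordinal im) && (k != Ordinal jm)) g k).
  rewrite (bigD1 (Ordinal im)) //= (bigD1 (Ordinal jm)) //=.
  by rewrite -(inj_eq val_inj) /= eq_sym.
rewrite !dec; set S := \sum_(k < m | _) f k; set S' := \sum_(k < m | _) f' k.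
have -> : S = S' by apply: eq_bigr => k /andP[ki kj]; exact: ff'.
by lia.
Qed.

Section Gain.
Variables (l m n e : nat) (s s' : bool) (x y : nat -> nat).
Hypothesis l_gt1 : 1 < l.
Hypothesis xl : forall i, l.-1 <= x i <= l.+1.
Hypothesis yl : forall i, l.-1 <= y i <= l.+1.
Hypothesis mn : m * l.+1 <= n.
Hypothesis loss_lt : n < block_lcs s s' n x y + l.-1 * e.+1.

Definition swap i j := upd (upd x i l) j l.

(** An optimal cut for [x] is also a cut for [swap i j]. Since [x i + x j = l + l], the tail after
    block [m] is the same, and only the terms [i] and [j] of the score change. [G] is the set of
    good blocks, [h] their partners in Y, and [N] counts the symbols of the right colour in each
    segment. *)
Lemma block_alignment : exists (G : nat -> bool) (h N : nat -> nat),
  [/\ forall i, G i -> i < m,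
      forall i j, G i -> G j -> i < j -> h i < h j,
      forall i, G i -> h i * l.-1 < n,
      \sum_(i < m) ~~ G i <= 2 + 4 * e &
      (forall i, G i -> N i = y (h i)) /\
      forall i j, i != j -> i < m -> j < m -> x i + x j = l + l ->
        block_lcs s s' n x y + (minn l (N i) + minn l (N j)) <=
        block_lcs s s' n (swap i j) y + (minn (x i) (N i) + minn (x j) (N j))].
Proof.
have x0 i : 0 < x i by have := xl i; lia.
have y0 i : 0 < y i by have := yl i; lia.
have ya i : l.-1 <= y i by case/andP: (yl i).
have xa i : l.-1 <= x i by case/andP: (xl i).
have start_le : block_start x m <= n.
  by apply: leq_trans mn; apply: block_start_ub => i; case/andP: (xl i).
pose r := n - block_start x m; have En : n = block_start x m + r by rewrite subnKC.
pose Q := block_string (s (+) odd m) (fun i => x (m + i)) r.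
have Ex : block_string s x n = block_prefix x s m ++ Q by rewrite En block_stringE.
set Y := block_string s' y n.
have [t [cut_t score_t max_t]] := optimal_cut_exists s Y x m Q.
pose G := good_block s s' y m n l.-1 t.
have goodP i (Gi : G i) := good_blockP y0 ya cut_t score_t max_t Gi.
pose N i := symbols Y (s (+) odd i) (t i) (t i.+1).
exists G, (fun i => block_of y (t i)), N; split.
- by move=> i /and3P[_ im _]; exact: ltnW.
- move=> i j Gi Gj ij; have [_ E2 _] := goodP i Gi; have [E1 _ _] := goodP j Gj.
  have jm : j <= m by move: Gj => /and3P[_ jm _]; lia.
  rewrite ltnNge; apply/negP => /(leq_block_start y); rewrite -E1.
  have := cut_leq cut_t (i := i.+1) (j := j); rewrite ij jm => /(_ isT).
  have := y0 (block_of y (t i)); rewrite E2 block_startS; lia.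
- move=> i Gi; have [E1 E2 _] := goodP i Gi.
  have im : i < m by move: Gi => /and3P[_ im _]; lia.
  apply: leq_ltn_trans (block_start_lb _ ya) _; rewrite -E1.
  move: (cut_leq_size cut_t im); have := y0 (block_of y (t i)).
  by rewrite E2 block_startS -E1; lia.
- apply: (bad_blocks_le xa cut_t score_t).
  + by rewrite size_block_string -En -Ex.
  + by rewrite -Ex.
split=> [i Gi|i j ij im jm Exx]; first by have [_ _] := goodP i Gi.
have swap_i : swap i j i = l by rewrite /swap /upd (negbTE ij) eqxx.
have swap_j : swap i j j = l by rewrite /swap /upd eqxx.
have swap_k k : k != i -> k != j -> x k = swap i j k.
  by move=> /negbTE ki /negbTE kj; rewrite /swap /upd ki kj.
have Estart : block_start x m = block_start (swap i j) m.
  by have := sum_change2 ij im jm swap_k; rewrite swap_i swap_j Exx => /addIn.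
have Exs : block_string s (swap i j) n = block_prefix (swap i j) s m ++ Q.
  rewrite En Estart block_stringE; last first.
    by move=> k; rewrite /swap /upd; case: ifP => _; [|case: ifP => _]; rewrite ?x0 //; lia.
  congr (_ ++ _); apply: block_string_ext => k _; apply/esym/swap_k; apply/eqP; lia.
rewrite /block_lcs Ex Exs -/Y.
apply: leq_trans (leq_add (cut_score_le _ _ _ cut_t) (leqnn _)).
apply: leq_trans (leq_add score_t (leqnn _)) _.
rewrite /cut_score addnAC [leqRHS]addnAC leq_add2r.
have := @sum_change2 m (fun k => minn (x k) (N k)) (fun k => minn (swap i j k) (N k)) i j.
by rewrite swap_i swap_j => -> // k ki kj; rewrite -swap_k.
Qed.

End Gain.

(** * Coding monotone partial matchings by their domain and range *)

Section Encoding.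
Variables (m q : nat).

(* [h] maps the [k]-th element of [G] to the [k]-th element of [H]; indices    *)
(* outside [G] are sent to distinct values above [q], which keeps it injective. *)
Definition encode (G H : nat -> bool) i :=
  if (i < m) && G i
  then nth (q + i) (seq.filter H (iota 0 q)) (count G (iota 0 i)) else q + i.

Lemma encode_cases G H i : encode G H i = q + i \/
  [/\ G i, count G (iota 0 i) < size (seq.filter H (iota 0 q)), encode G H i < q &
   encode G H i = nth 0 (seq.filter H (iota 0 q)) (count G (iota 0 i))].
Proof.
rewrite /encode; case: andP => [[_ Gi]|]; last by left.
case: (ltnP (count G (iota 0 i)) (size (seq.filter H (iota 0 q)))) => ci; last first.
  by left; rewrite nth_default.
right; split=> //; last exact: set_nth_default.
by have := mem_nth (q + i) ci; rewrite mem_filter mem_iota => /and3P[].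
Qed.

Lemma encode_inj G H i j : encode G H i = encode G H j -> i = j.
Proof.
have count_lt i' j' : G i' -> i' < j' -> count G (iota 0 i') < count G (iota 0 j').
  move=> Gi /subnKC <-; rewrite (iotaD 0 i'.+1) -[i'.+1]addn1 (iotaD 0 i' 1).
  by rewrite !count_cat /= add0n Gi; lia.
move=> E; have [Ei|[Gi ci li Ei]] := encode_cases G H i;
  have [Ej|[Gj cj lj Ej]] := encode_cases G H j; try by lia.
move: E; rewrite Ei Ej => /eqP; rewrite nth_uniq ?filter_uniq ?iota_uniq // => /eqP cij.
by case: (ltngtP i j) => // ij; have := count_lt _ _ _ ij; rewrite ?Gi ?Gj => /(_ isT); lia.
Qed.

(** [H] is the image of [G]; as [h] is increasing, [G] and [H] determine it on [G]. The final
    identity says that [G] and [H] have equally many elements. *)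
Lemma encode_exists (G : nat -> bool) (h : nat -> nat) :
  (forall i j, G i -> G j -> i < j -> h i < h j) ->
  (forall i, i < m -> G i -> h i < q) ->
  exists H : nat -> bool, [/\ forall j, H j -> j < q,
    forall i, i < m -> G i -> encode G H i = h i &
    \sum_(j < q) ~~ H j + m = q + \sum_(i < m) ~~ G i].
Proof.
move=> h_mono h_lt; pose H j := j \in map h (seq.filter G (iota 0 m)).
have HE : seq.filter H (iota 0 q) = map h (seq.filter G (iota 0 m)).
  apply: (irr_sorted_eq ltn_trans ltnn).
  - by apply: sorted_filter; [exact: ltn_trans | exact: iota_ltn_sorted].
  - have : sorted ltn (seq.filter G (iota 0 m)).
      by apply: sorted_filter; [exact: ltn_trans | exact: iota_ltn_sorted].
    have : all G (seq.filter G (iota 0 m)) by exact: filter_all.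
    case: (seq.filter _ _) => //= a r /andP[Ga]; elim: r a Ga => //= b r IH a Ga.
    by move=> /andP[Gb Gr] /andP[ab br]; rewrite h_mono //= IH.
  move=> j; rewrite mem_filter mem_iota /= add0n -/(H j); case: (boolP (H j)) => //=.
  by move=> /mapP[i]; rewrite mem_filter mem_iota => /andP[Gi im] ->; rewrite h_lt.
have Hlt j : H j -> j < q.
  by move=> /mapP[i]; rewrite mem_filter mem_iota => /andP[Gi im] ->; rewrite h_lt.
have count_sum (P : nat -> bool) k : count P (iota 0 k) + \sum_(i < k) ~~ P i = k.
  elim: k => [|k IH]; first by rewrite big_ord0.
  rewrite big_ord_recr -[X in iota 0 X]addn1 iotaD count_cat /= add0n.
  by rewrite addn0 addnACA IH -[RHS]addn1; case: (P k).
exists H; split=> // [i im Gi|].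
  rewrite /encode im Gi HE -(subnKC im) (iotaD 0 i.+1) filter_cat -[i.+1]addn1 (iotaD 0 i 1).
  rewrite filter_cat /= Gi add0n map_cat map_cat -catA nth_cat size_map.
  by rewrite size_filter ltnn subnn.
have := count_sum H q; have := count_sum G m.
by rewrite -!size_filter HE size_map; lia.
Qed.

End Encoding.

Local Open Scope ring_scope.

(** * Weighted sums over finite products *)

Definition scons (T : Type) (a : T) (x : nat -> T) i := if i is j.+1 then x j else a.

Lemma scons_eta (T : Type) (x : nat -> T) : scons (x 0%N) (fun i => x i.+1) = x.
Proof. by apply: funext => -[]. Qed.

Lemma upd_scons0 (T : Type) (a v : T) x : upd (scons a x) 0 v = scons v x.
Proof. by apply: funext => -[]. Qed.

Lemma upd_sconsS (T : Type) (a v : T) x i : upd (scons a x) i.+1 v = scons a (upd x i v).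
Proof. by apply: funext => -[]. Qed.

Section WeightedSum.
Variables (R : realFieldType) (T : eqType).
Variables (w : R) (A : seq T) (d : T).
Implicit Types (n : nat) (F G : (nat -> T) -> R) (x : nat -> T).

(** The inverse of the size of [A] as weight gives the uniform mean; [w = 1] gives plain sums, used
    for the union bound and for decompositions into atoms. *)
Definition wsum (f : T -> R) := w * \sum_(a <- A) f a.

Lemma wsum_lin c f g : wsum (fun a => c * f a + g a) = c * wsum f + wsum g.
Proof. by rewrite /wsum big_split /= -mulr_sumr; ring. Qed.

Lemma eq_wsum f g : (forall a, a \in A -> f a = g a) -> wsum f = wsum g.
Proof. by move=> fg; congr (w * _); exact: eq_big_seq. Qed.

Lemma wsumZ c f : wsum (fun a => c * f a) = c * wsum f.
Proof. by rewrite /wsum -mulr_sumr mulrCA. Qed.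

(* Entries from index [n] on are set to the default [d]. *)
Fixpoint wsums n F : R :=
  if n is n'.+1 then wsum (fun a => wsums n' (fun x => F (scons a x))) else F (fun=> d).

Definition wdom n x := (forall i, (i < n)%N -> x i \in A) /\ forall i, (n <= i)%N -> x i = d.

Lemma wdom_scons n a x : a \in A -> wdom n x -> wdom n.+1 (scons a x).
Proof. by move=> aA [xA xd]; split=> -[|i] // i_n; [exact: xA | exact: xd]. Qed.

Lemma eq_wsums n F G : (forall x, wdom n x -> F x = G x) -> wsums n F = wsums n G.
Proof.
elim: n F G => [|n IH] F G FG /=; first by apply: FG; split.
congr (w * _); apply: eq_big_seq => a aA; apply: IH => x xd.
by apply: FG; exact: wdom_scons.
Qed.

Lemma wsums_lin n c F G :
  wsums n (fun x => c * F x + G x) = c * wsums n F + wsums n G.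
Proof.
elim: n F G => //= n IH F G; rewrite -wsum_lin.
by congr (w * _); apply: eq_bigr => a _; rewrite IH.
Qed.

Lemma wsums0 n : wsums n (fun=> 0) = 0.
Proof.
elim: n => //= n ->; rewrite /wsum big1 ?mulr0 //.
Qed.

Lemma wsumsZ n c F : wsums n (fun x => c * F x) = c * wsums n F.
Proof.
have := wsums_lin n c F (fun=> 0); rewrite wsums0 addr0 => <-.
by apply: eq_wsums => x _; rewrite addr0.
Qed.

Lemma wsumsD n F G : wsums n (fun x => F x + G x) = wsums n F + wsums n G.
Proof.
have := wsums_lin n 1 F G; rewrite mul1r => <-.
by apply: eq_wsums => x _; rewrite mul1r.
Qed.

Lemma wsumsB n F G : wsums n (fun x => F x - G x) = wsums n F - wsums n G.
Proof.
have := wsums_lin n (-1) G F; rewrite mulN1r addrC => <-.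
by apply: eq_wsums => x _; rewrite mulN1r addrC.
Qed.

Lemma wsums_sum n (I : Type) (r : seq I) (P : pred I) (F : I -> (nat -> T) -> R) :
  wsums n (fun x => \sum_(i <- r | P i) F i x) = \sum_(i <- r | P i) wsums n (F i).
Proof.
elim: r => [|i r IH].
  by rewrite big_nil -[RHS](wsums0 n); apply: eq_wsums => x _; rewrite big_nil.
rewrite big_cons -IH; case: ifP => Pi; rewrite -?wsumsD; apply: eq_wsums => x _;
  by rewrite big_cons Pi.
Qed.

Lemma wsums_prod n (f : nat -> T -> R) :
  wsums n (fun x => \prod_(i < n) f i (x i)) = \prod_(i < n) wsum (f i).
Proof.
elim: n f => [|n IH] f /=; first by rewrite !big_ord0.
rewrite big_ord_recl -(IH (fun i => f i.+1)) /wsum -mulrA mulr_suml; congr (w * _).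
apply: eq_bigr => a _; rewrite -wsumsZ; apply: eq_wsums => x _.
by rewrite big_ord_recl.
Qed.

Section Monotone.
Hypothesis w_ge0 : 0 <= w.

Lemma ler_wsum f g : (forall a, a \in A -> f a <= g a) -> wsum f <= wsum g.
Proof.
move=> fg; rewrite /wsum ler_wpM2l // !big_seq; exact: ler_sum.
Qed.

Lemma ler_wsums n F G : (forall x, wdom n x -> F x <= G x) -> wsums n F <= wsums n G.
Proof.
elim: n F G => [|n IH] F G FG /=; first by apply: FG; split.
apply: ler_wsum => a aA; apply: IH => x xd.
by apply: FG; exact: wdom_scons.
Qed.

End Monotone.

Lemma wsums_ge n F x : w = 1 -> (forall x', 0 <= F x') -> wdom n x -> F x <= wsums n F.
Proof.
move=> w1 F0; elim: n x F F0 => [|n IH] x F F0 [xA xd] /=.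
  by rewrite (_ : x = fun=> d) //; apply: funext => i; exact: xd.
have wsums_ge0 G k : (forall x', 0 <= G x') -> 0 <= wsums k G.
  move=> G0; rewrite -(wsums0 k); apply: ler_wsums => [|x' _]; last exact: G0.
  by rewrite w1.
rewrite /wsum w1 mul1r (big_rem (x 0%N)) /=; last exact: xA.
rewrite -{1}(scons_eta x) -[leLHS]addr0 lerD //.
  apply: (IH (fun i => x i.+1) (fun x' => F (scons (x 0%N) x'))) => [x'|]; first exact: F0.
  by split=> i i_n; [exact: xA | exact: xd].
by apply: sumr_ge0 => a _; apply: wsums_ge0 => x'; exact: F0.
Qed.

Section Normalized.
Hypothesis w_norm : w * (size A)%:R = 1.

Lemma wsum_cst c : wsum (fun=> c) = c.
Proof.
by rewrite /wsum big_const_seq count_predT iter_addr_0 -mulr_natl mulrA w_norm mul1r.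
Qed.

Lemma wsums_cst n c : wsums n (fun=> c) = c.
Proof.
elim: n => //= n IH; rewrite -[RHS]wsum_cst /wsum; congr (w * _).
by apply: eq_bigr => a _.
Qed.

Lemma wsums_resample n F i : (i < n)%N ->
  wsums n F = wsums n (fun x => wsum (fun a => F (upd x i a))).
Proof.
elim: n F i => // n IH F [|i] /=.
  move=> _; rewrite -[LHS]wsum_cst; congr (w * _); apply: eq_bigr => a _.
  rewrite /wsum -wsums_sum -wsumsZ; apply: eq_wsums => x _; congr (w * _).
  by apply: eq_bigr => v _; rewrite upd_scons0.
rewrite ltnS => i_n; congr (w * _); apply: eq_bigr => a _.
rewrite (IH _ i i_n); apply: eq_wsums => x _; congr (w * _).
by apply: eq_bigr => v _; rewrite upd_sconsS.
Qed.

Lemma wsums_resample2 n F i j : (i < n)%N -> (j < n)%N ->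
  wsums n F = wsums n (fun x => wsum (fun a => wsum (fun b => F (upd (upd x i a) j b)))).
Proof.
move=> i_n j_n; rewrite (wsums_resample F j_n) (wsums_resample _ i_n).
by apply: eq_wsums => x _.
Qed.

Lemma wsumsS_ext n F :
  (forall x x', (forall i, (i < n)%N -> x i = x' i) -> F x = F x') ->
  wsums n.+1 F = wsums n F.
Proof.
elim: n F => [|n IH] F extF.
  rewrite /= -[RHS]wsum_cst; congr (w * _); apply: eq_bigr => a _; exact: extF.
rewrite [LHS]/= [RHS]/=; congr (w * _); apply: eq_bigr => a _.
by apply: (IH (fun x => F (scons a x))) => x x' xx'; apply: extF => -[].
Qed.

(** Independence: the pairs read disjoint coordinates, so the last one can be resampled and pulled
    out. *)
Lemma wsums_prod_pairs n m (f : nat -> T -> T -> R) (h : nat -> nat) :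
  (forall i, (i < m.*2)%N -> (h i < n)%N) ->
  (forall i j, (i < m.*2)%N -> (j < m.*2)%N -> h i = h j -> i = j) ->
  wsums n (fun x => \prod_(k < m) f k (x (h k.*2)) (x (h k.*2.+1))) =
  \prod_(k < m) wsum (fun a => wsum (fun b => f k a b)).
Proof.
elim: m => [|m IH] h_lt h_inj.
  by rewrite !big_ord0 -[RHS](wsums_cst n); apply: eq_wsums => x _; rewrite big_ord0.
have h1 : (h m.*2 < n)%N by apply: h_lt; lia.
have h2 : (h m.*2.+1 < n)%N by apply: h_lt; lia.
rewrite big_ord_recr (wsums_resample2 _ h1 h2) /= -IH; last 2 first.
- by move=> i i_m; apply: h_lt; lia.
- by move=> i j i_m j_m; apply: h_inj; lia.
rewrite mulrC -wsumsZ; apply: eq_wsums => x _.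
rewrite mulrC -wsumZ; apply: eq_wsum => a _; rewrite -wsumZ; apply: eq_wsum => b _.
have neq : h m.*2 != h m.*2.+1 by apply/eqP => /h_inj; lia.
rewrite big_ord_recr /=; congr (_ * _); last by rewrite /upd eqxx (negbTE neq) eqxx.
have old i : (i < m.*2)%N -> upd (upd x (h m.*2) a) (h m.*2.+1) b (h i) = x (h i).
  by move=> im; rewrite /upd !ifF //; apply/eqP => /h_inj; lia.
by apply: eq_bigr => k _; rewrite !old //; have := ltn_ord k; lia.
Qed.

Hypothesis w_ge0 : 0 <= w.
Hypothesis dA : d \in A.

Lemma wsum_var_le f (c : R) : 0 <= c -> (forall a, a \in A -> `|f a - f d| <= c) ->
  wsum (fun a => f a ^+ 2) - wsum f ^+ 2 <= c ^+ 2.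
Proof.
move=> c0 fc; have E : wsum (fun a => (f a - f d) ^+ 2) =
    wsum (fun a => f a ^+ 2) - 2 * f d * wsum f + f d ^+ 2.
  transitivity (wsum (fun a => - (2 * f d) * f a + (1 * f a ^+ 2 + f d ^+ 2))).
    by apply: eq_wsum => a _; ring.
  by rewrite !wsum_lin wsum_cst; ring.
have : wsum (fun a => (f a - f d) ^+ 2) <= wsum (fun=> c ^+ 2).
  by apply: ler_wsum => // a aA; rewrite -real_normK ?num_real // lerXn2r ?nnegrE // fc.
rewrite wsum_cst E; have := sqr_ge0 (wsum f - f d); lra.
Qed.

Lemma ler_norm_wsums n F G c :
  (forall x, wdom n x -> `|F x - G x| <= c) -> `|wsums n F - wsums n G| <= c.
Proof.
move=> FG; rewrite -wsumsB ler_norml -[in leLHS](wsums_cst n (- c)).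
rewrite -[X in _ && (_ <= X)](wsums_cst n c).
by apply/andP; split; apply: ler_wsums => // x xd; have := FG x xd;
  rewrite ler_norml => /andP[].
Qed.

(** Efron-Stein with bounded differences, by the law of total variance: given the first entry, the
    conditional variances are bounded by induction and the variance of the conditional mean [H] by
    [wsum_var_le]. *)
Lemma wsums_var_le n F (c : R) : 0 <= c ->
  (forall x i a, wdom n x -> (i < n)%N -> a \in A -> `|F (upd x i a) - F x| <= c) ->
  wsums n (fun x => F x ^+ 2) - wsums n F ^+ 2 <= n%:R * c ^+ 2.
Proof.
move=> c0; elim: n F => [|n IH] F FC /=; first by rewrite subrr mul0r.
pose H a := wsums n (fun x => F (scons a x)).
have le1 : wsum (fun a => wsums n (fun x => F (scons a x) ^+ 2) - H a ^+ 2) <=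
    n%:R * c ^+ 2.
  rewrite -[leRHS]wsum_cst; apply: ler_wsum => // a aA.
  apply: IH => x i v xd i_n vA; rewrite -upd_sconsS; apply: FC => //.
  exact: wdom_scons.
have le2 : wsum (fun a => H a ^+ 2) - wsum H ^+ 2 <= c ^+ 2.
  apply: wsum_var_le => // a aA; apply: ler_norm_wsums => x xd.
  by have := FC (scons d x) 0%N a; rewrite upd_scons0; apply => //; exact: wdom_scons.
have := wsum_lin (-1) (fun a => H a ^+ 2) (fun a => wsums n (fun x => F (scons a x) ^+ 2)).
have -> : wsum (fun a => -1 * H a ^+ 2 + wsums n (fun x => F (scons a x) ^+ 2)) =
  wsum (fun a => wsums n (fun x => F (scons a x) ^+ 2) - H a ^+ 2).
  by congr (w * _); apply: eq_bigr => a _; rewrite mulN1r addrC.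
move=> E; rewrite -/H -natr1; move: le1 le2 E; rewrite -/H.
by set a1 := wsum _; set a2 := wsum _; set a3 := wsum H; set a4 := wsum _; lra.
Qed.

End Normalized.

End WeightedSum.

Lemma wsums_swap (R : realFieldType) (T T' : eqType) (w w' : R) (A : seq T) (A' : seq T')
    d d' n n' F :
  wsums w A d n (fun x => wsums w' A' d' n' (F x)) =
  wsums w' A' d' n' (fun y => wsums w A d n (F^~ y)).
Proof.
elim: n F => //= n IH F; rewrite /wsum wsumsZ wsums_sum; congr (w * _).
by apply: eq_bigr => a _; rewrite IH.
Qed.

(** * The test function *)

Section TestFunction.
Variables (R : realFieldType) (l : nat).
Hypothesis l_gt0 : (0 < l)%N.

Definition lengths := [:: l.-1; l; l.+1].
Definition mean := wsum (3%:R^-1 : R) lengths.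
Definition means n (F : (nat -> nat) -> R) := wsums (3%:R^-1) lengths l n F.

Lemma mean_norm : (3%:R^-1 : R) * (size lengths)%:R = 1.
Proof. by rewrite mulVf // pnatr_eq0. Qed.

Lemma meanE f : mean f = (f l.-1 + f l + f l.+1) / 3%:R.
Proof. by rewrite /mean /wsum !big_cons big_nil addr0 mulrC !addrA. Qed.

Lemma mean_weight_ge0 : 0 <= 3%:R^-1 :> R.
Proof. by rewrite invr_ge0 ler0n. Qed.

Lemma l_in_lengths : l \in lengths.
Proof. by rewrite !inE eqxx orbT. Qed.

Lemma lengths_bounds n x : wdom lengths l n x -> forall i, (l.-1 <= x i <= l.+1)%N.
Proof.
move=> [xA xd] i; case: (ltnP i n) => [/xA|/xd ->]; last by lia.
by rewrite !inE => /or3P[] /eqP ->; lia.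
Qed.

Let l1l : (l.-1 == l) = false. Proof. by apply/eqP; lia. Qed.
Let l1l1 : (l.-1 == l.+1) = false. Proof. by apply/eqP; lia. Qed.
Let ll1 : (l == l.+1) = false. Proof. by apply/eqP; lia. Qed.
Let l_l1 : (l == l.-1) = false. Proof. by apply/eqP; lia. Qed.
Let lS_l : (l.+1 == l) = false. Proof. by apply/eqP; lia. Qed.
Let lS_l1 : (l.+1 == l.-1) = false. Proof. by apply/eqP; lia. Qed.
Definition lengths_eqE := (l1l, l1l1, ll1, l_l1, lS_l, lS_l1, eqxx).

Definition short_long a b := (a == l.-1) && (b == l.+1).
Definition mixed a b := short_long a b || short_long b a.

(** The values 2, -1, 0 have probabilities 1/9, 2/9, 6/9: mean 0 and mean square 2/3. *)
Definition pair_test a b : R :=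
  if (a == l) && (b == l) then 2 else if mixed a b then -1 else 0.

Definition test m x := \sum_(k < m) pair_test (x k.*2) (x k.*2.+1).

Definition equalize x k := swap l x k.*2 k.*2.+1.

Definition gain m (F : (nat -> nat) -> R) x :=
  \sum_(k < m) if mixed (x k.*2) (x k.*2.+1) then F (equalize x k) - F x else 0.

Lemma means_resample_pair n F k : (k.*2.+1 < n)%N ->
  means n F = means n (fun x => mean (fun a => mean (fun b =>
    F (upd (upd x k.*2 a) k.*2.+1 b)))).
Proof. by move=> kn; apply: (wsums_resample2 _ mean_norm) => //; exact: ltnW. Qed.

Lemma updE (x : nat -> nat) k a b :
  (upd (upd x k.*2 a) k.*2.+1 b k.*2 = a) * (upd (upd x k.*2 a) k.*2.+1 b k.*2.+1 = b).
Proof. by rewrite /upd eqxx ifF ?eqxx //; apply/eqP; lia. Qed.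

Lemma test_upd x m a b : test m (upd (upd x m.*2 a) m.*2.+1 b) = test m x.
Proof.
by apply: eq_bigr => k _; have km := ltn_ord k; rewrite /upd !ifF //; apply/eqP; lia.
Qed.

(** Average over one pair with the rest fixed: the value 2 at [(l, l)] supplies the equalised value
    once for each of the two mixed pairs, whose own value enters with -1. *)
Lemma means_gain n m F : (m.*2 <= n)%N -> means n (fun x => F x * test m x) = means n (gain m F).
Proof.
move=> mn; rewrite /means.
transitivity (\sum_(k < m) means n (fun x => F x * pair_test (x k.*2) (x k.*2.+1))).
  by rewrite /means -wsums_sum; apply: eq_wsums => x _; rewrite mulr_sumr.
rewrite /gain wsums_sum; apply: eq_bigr => k _; rewrite -/(means n _).
have kn : (k.*2.+1 < n)%N by have := ltn_ord k; lia.
rewrite (means_resample_pair _ kn) [in RHS](means_resample_pair _ kn).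
apply: eq_wsums => x _; rewrite !meanE !updE.
rewrite /pair_test /mixed /short_long !lengths_eqE /=.
have E a b : equalize (upd (upd x k.*2 a) k.*2.+1 b) k = equalize x k.
  by apply: funext => j; rewrite /equalize /swap /upd; case: eqP => // _; case: eqP.
rewrite !E -/(swap l x k.*2 k.*2.+1) -/(equalize x k); by field.
Qed.

Lemma means_test0 n m : (m.*2 <= n)%N -> means n (test m) = 0.
Proof.
move=> mn; rewrite -[RHS](wsums0 (3%:R^-1 : R) lengths l n).
transitivity (means n (fun x => (fun=> 1) x * test m x)).
  by apply: eq_wsums => x _; rewrite mul1r.
rewrite means_gain //; apply: eq_wsums => x _; apply: big1 => k _.
by rewrite subrr if_same.
Qed.

Lemma means_test_sqr n m : (m.*2 <= n)%N ->
  means n (fun x => test m x ^+ 2) = 2 / 3 * m%:R.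
Proof.
elim: m => [|m IH] mn.
  rewrite mulr0 -[RHS](wsums0 (3%:R^-1 : R) lengths l n).
  by apply: eq_wsums => x _; rewrite /test big_ord0 expr0n.
have mn' : (m.*2 <= n)%N by lia.
rewrite (@means_resample_pair _ _ m); last by lia.
transitivity (means n (fun x => test m x ^+ 2 + 2 / 3)).
  apply: eq_wsums => x _; rewrite !meanE /test !big_ord_recr /=.
  rewrite -!/(test m _) !test_upd !updE /pair_test /mixed /short_long !lengths_eqE /=.
  by field.
by rewrite /means wsumsD (wsums_cst _ mean_norm) -/(means n _) IH // -natr1; field.
Qed.

(* Expand the mean of [(F - c - lam * test) ^+ 2]. *)
Lemma means_sqr_ge n m F c lam : (m.*2 <= n)%N ->
  2 * lam * means n (gain m F) - lam ^+ 2 * (2 / 3 * m%:R) <=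
  means n (fun x => (F x - c) ^+ 2).
Proof.
move=> mn; rewrite -means_gain // -(means_test_sqr mn).
have E : means n (fun x => 2 * lam * (F x * test m x) -
    lam ^+ 2 * test m x ^+ 2 - 2 * lam * c * test m x) =
    2 * lam * means n (fun x => F x * test m x) -
    lam ^+ 2 * means n (fun x => test m x ^+ 2).
  by rewrite /means !wsumsB !wsumsZ -!/(means n _) means_test0 // mulr0 subr0.
rewrite -E; apply: ler_wsums => [|x _]; first exact: mean_weight_ge0.
by have := sqr_ge0 (F x - c - lam * test m x); lra.
Qed.

(** Factor contributed to 2^-D by block [a] of the pair when matched with a block of length [p]:
    lengthening [l.-1] to [l] gains a symbol if [l <= p], shortening [l.+1] to [l] loses one if
    [l < p]. *)
Definition align_weight a b p : R :=
  if short_long a b then (if (l <= p)%N then 2^-1 else 1)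
  else if short_long b a then (if (l < p)%N then 2 else 1) else 1.

Definition pair_weight a b p q := align_weight a b p * align_weight b a q.

Lemma pair_weight_ge a b p q : 2^-1 <= pair_weight a b p q.
Proof.
rewrite /pair_weight /align_weight; case: (boolP (short_long a b)) => Sab.
  rewrite (_ : short_long b a = false); last first.
    by apply/negbTE/negP => /andP[_ /eqP Ea]; move: Sab; rewrite Ea /short_long; lia.
  by case: ifP => _; case: ifP => _; lra.
by case: (short_long b a); (do 2 ?case: ifP => _); lra.
Qed.

(** In a mixed pair the short block averages 2/3 and the long one 4/3. *)
Lemma mean_pair_weight a b :
  mean (fun p => mean (fun q => pair_weight a b p q)) = if mixed a b then 8 / 9 else 1.
Proof.
have L1 : (l <= l.-1)%N = false by lia.
have L2 : (l < l.-1)%N = false by lia.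
have L3 : (l < l.+1)%N by lia.
have E : (l <= l.+1)%N by lia.
rewrite !meanE /pair_weight /align_weight /mixed.
case: (boolP (short_long a b)) => Sab; last first.
  case: (short_long b a); rewrite ?L1 ?L2 ?L3 ?E ?ltnn ?leqnn /=; by field.
rewrite (_ : short_long b a = false); last first.
  by apply/negbTE/negP => /andP[_ /eqP Ea]; move: Sab; rewrite Ea /short_long; lia.
rewrite ?L1 ?L2 ?L3 ?E ?ltnn ?leqnn /=; by field.
Qed.

(** For a fixed pairing the pairs are independent. A pair is mixed with probability 2/9, and 7/9 +
    2/9 * 8/9 = 79/81. *)
Lemma means_pair_weight n m h :
  (m.*2 <= n)%N -> (forall i, (i < m.*2)%N -> (h i < n)%N) -> injective h ->
  means n (fun y => means n (fun x =>
    \prod_(k < m) pair_weight (x k.*2) (x k.*2.+1) (y (h k.*2)) (y (h k.*2.+1)))) =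
  (79 / 81) ^+ m.
Proof.
move=> mn h_lt h_inj; rewrite /means wsums_swap.
transitivity (means n (fun x => \prod_(k < m)
    (if mixed (x k.*2) (x k.*2.+1) then 8 / 9 else 1))).
  apply: eq_wsums => x _.
  rewrite (@wsums_prod_pairs _ _ _ _ _ mean_norm n m
    (fun k => pair_weight (x k.*2) (x k.*2.+1)) h) //; last by move=> i j _ _ /h_inj.
  by apply: eq_bigr => k _; exact: mean_pair_weight.
rewrite /means (@wsums_prod_pairs _ _ _ _ _ mean_norm n m
  (fun=> fun a b => if mixed a b then 8 / 9 else 1) id) //; last first.
  by move=> i im; exact: leq_trans mn.
rewrite prodr_const card_ord; congr (_ ^+ _); rewrite -/mean !meanE.
by rewrite /mixed /short_long !lengths_eqE /=; field.
Qed.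

End TestFunction.

(** * The mean gain *)

Lemma sum_double (f : nat -> nat) m :
  (\sum_(k < m) (f k.*2 + f k.*2.+1) = \sum_(i < m.*2) f i)%N.
Proof.
elim: m => [|m IH]; first by rewrite !big_ord0.
by rewrite big_ord_recr /= IH doubleS !big_ord_recr /= addnA.
Qed.

Section Drift.
Variables (R : realFieldType) (l : nat) (s s' : bool) (n m : nat).
Hypothesis l_gt1 : (1 < l)%N.
Hypothesis mn : (m.*2 * l.+1 <= n)%N.

Local Notation L := (block_lcs s s' n).

(* This is [2^-D], with [D] the [gain] of [L], written with natural exponents. *)
Definition gain_weight (x y : nat -> nat) : R :=
  \prod_(k < m) if mixed l (x k.*2) (x k.*2.+1)
                then 2 * 2^-1 ^+ ((L (equalize l x k) y).+1 - L x y) else 1.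

Lemma mixedE a b : mixed l a b -> (a + b = l + l)%N.
Proof. by case/orP => /andP[/eqP -> /eqP ->]; lia. Qed.

(** Compare factor by factor. If both blocks of a pair are good, [block_alignment] bounds the factor
    by [pair_weight]. Otherwise the factor is at most 2, and the 4 paid for a bad block suffices
    because [pair_weight] is at least 1/2. *)
Lemma gain_weight_le x y e q :
  (forall i, (l.-1 <= x i <= l.+1)%N) -> (forall i, (l.-1 <= y i <= l.+1)%N) ->
  (n < L x y + l.-1 * e.+1)%N -> (n <= q * l.-1)%N ->
  exists G H : nat -> bool,
  [/\ forall i, G i -> (i < m.*2)%N, forall j, H j -> (j < q)%N,
      (\sum_(i < m.*2) ~~ G i <= 2 + 4 * e)%N,
      (\sum_(j < q) ~~ H j + m.*2 <= q + (2 + 4 * e))%N &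
      gain_weight x y <= 4 ^+ (2 + 4 * e) *
        \prod_(k < m) pair_weight R l (x k.*2) (x k.*2.+1)
          (y (encode m.*2 q G H k.*2)) (y (encode m.*2 q G H k.*2.+1))].
Proof.
move=> xl yl loss nq.
have [G [h [N [Gm h_mono h_lt badG [NG gainN]]]]] :=
  block_alignment l_gt1 xl yl mn loss.
have h_lt_q i : (i < m.*2)%N -> G i -> (h i < q)%N.
  move=> _ /h_lt lt_n; have := leq_trans lt_n nq; rewrite ltn_mul2r; lia.
have [H [Hq encH cardH]] := encode_exists h_mono h_lt_q.
exists G, H; split=> //; first by lia.
set g := encode _ _ _ _ in encH *.
pose B := (\sum_(i < m.*2) ~~ G i)%N.
have le_pow : 4 ^+ B <= 4 ^+ (2 + 4 * e) :> R by rewrite ler_eXn2l // ltr1n.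
have pw_ge0 k : 0 <= pair_weight R l (x k.*2) (x k.*2.+1) (y (g k.*2)) (y (g k.*2.+1)).
  by apply: le_trans (pair_weight_ge _ _ _ _ _ _); [lra | lia].
apply: le_trans (ler_wpM2r _ le_pow); last by apply: prodr_ge0.
rewrite /B -(sum_double (fun i => ~~ G i : nat)) expr_sum -big_split /=.
apply: ler_prod => k _; have km := ltn_ord k.
have im : (k.*2 < m.*2)%N by lia.
have jm : (k.*2.+1 < m.*2)%N by lia.
have ij : k.*2 != k.*2.+1 by apply/eqP; lia.
apply/andP; split.
  by case: ifP => // _; rewrite mulr_ge0 ?exprn_ge0 ?invr_ge0 ?ler0n.
have pw_ge := pair_weight_ge R (ltnW l_gt1) (x k.*2) (x k.*2.+1)
  (y (g k.*2)) (y (g k.*2.+1)).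
have u_le d : 2 * 2^-1 ^+ d <= 2 :> R.
  by rewrite -[leRHS]mulr1 ler_wpM2l // exprn_ile1 // ?invr_ge0 ?ler0n // invf_le1 ?ler1n.
have [/andP[Gi Gj]|bad] := boolP (G k.*2 && G k.*2.+1); last first.
  have -> : 4 ^+ (~~ G k.*2 + ~~ G k.*2.+1) = 4 * 4 ^+ (~~ G k.*2 + ~~ G k.*2.+1).-1 :> R.
    by rewrite -exprS prednK //; case: (G _) bad => //=; case: (G _).
  have ge1 : 1 <= 4 ^+ (~~ G k.*2 + ~~ G k.*2.+1).-1 :> R by rewrite exprn_ege1 // ler1n.
  have : 2 <= 4 * 4 ^+ (~~ G k.*2 + ~~ G k.*2.+1).-1 *
     pair_weight R l (x k.*2) (x k.*2.+1) (y (g k.*2)) (y (g k.*2.+1)) by nra.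
  by case: ifP => _; [exact: le_trans (u_le _) | lra].
rewrite Gi Gj expr0 mul1r.
case: ifP => [mix|]; last first.
  rewrite /pair_weight /align_weight /mixed => /negbT; rewrite negb_or.
  by move=> /andP[/negbTE -> /negbTE ->]; rewrite mulr1.
have := gainN _ _ ij im jm (mixedE mix).
rewrite !NG // -!encH // -/g -/(equalize l x k).
move: (L (equalize l x k) y) (L x y) (y (g k.*2)) (y (g k.*2.+1)) => u v a b.
rewrite /pair_weight /align_weight; case/orP: mix => sl.
  have ls : short_long l (x k.*2.+1) (x k.*2) = false.
    by apply/negbTE/negP => /andP[/eqP Ea _]; move: sl; rewrite Ea => /andP[_ /eqP]; lia.
  rewrite sl ls; case/andP: sl => /eqP -> /eqP ->.
  case: (leqP l a) => la; case: (ltnP l b) => lb le_uv.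
  - have [d ->] : exists d, (u.+1 - v = d.+1)%N by exists (u - v)%N; lia.
    by rewrite exprS; have := u_le d; lra.
  - have [d ->] : exists d, (u.+1 - v = d.+2)%N by exists (u - v).-1; lia.
    by rewrite !exprS; have := u_le d; lra.
  - by have := u_le (u.+1 - v)%N; lra.
  have [d ->] : exists d, (u.+1 - v = d.+1)%N by exists (u - v)%N; lia.
  by rewrite exprS; have := u_le d; lra.
have ls : short_long l (x k.*2) (x k.*2.+1) = false.
  by apply/negbTE/negP => /andP[/eqP Ea _]; move: sl; rewrite Ea => /andP[_ /eqP]; lia.
rewrite sl ls; case/andP: sl => /eqP -> /eqP ->.
case: (leqP l b) => lb; case: (ltnP l a) => la le_uv.
- have [d ->] : exists d, (u.+1 - v = d.+1)%N by exists (u - v)%N; lia.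
  by rewrite exprS; have := u_le d; lra.
- have [d ->] : exists d, (u.+1 - v = d.+2)%N by exists (u - v).-1; lia.
  by rewrite !exprS; have := u_le d; lra.
- by have := u_le (u.+1 - v)%N; lra.
have [d ->] : exists d, (u.+1 - v = d.+1)%N by exists (u - v)%N; lia.
by rewrite exprS; have := u_le d; lra.
Qed.

(** Ensures that the truncated subtraction in [gain_weight] is exact. *)
Lemma equalize_lcs_le x y k :
  (forall i, (l.-1 <= x i <= l.+1)%N) -> (forall i, (l.-1 <= y i <= l.+1)%N) ->
  (k < m)%N -> mixed l (x k.*2) (x k.*2.+1) -> (L x y <= (L (equalize l x k) y).+1)%N.
Proof.
move=> xl yl km mix.
(* The choice [e = n] makes the loss condition trivial; only the comparison of scores is wanted
   here. *)
have loss : (n < L x y + l.-1 * n.+1)%N.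
  by rewrite ltn_addl // leq_pmull //; lia.
have [G [h [N [_ _ _ _ [_ gainN]]]]] := block_alignment l_gt1 xl yl mn loss.
have ij : k.*2 != k.*2.+1 by apply/eqP; lia.
have := gainN k.*2 k.*2.+1 ij _ _ (mixedE mix); rewrite -/(equalize l x k).
have im : (k.*2.+1 < m.*2)%N by lia.
move=> /(_ (ltnW im) im); have := xl k.*2; have := xl k.*2.+1; have := mixedE mix; lia.
Qed.

Lemma pow2_bernoulli (a b : nat) : 1 + a%:R - b%:R <= 2 ^+ a * 2^-1 ^+ b :> R.
Proof.
have [ba|ab] := leqP b a.
  rewrite -(subnK ba) exprD -mulrA -exprMn divff ?pnatr_eq0 // expr1n mulr1 natrD.
  rewrite addrA addrK; elim: (a - b)%N => [|k IH]; first by rewrite expr0; lra.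
  rewrite exprS -natr1; have : 1 <= 2 ^+ k :> R by rewrite exprn_ege1 // ler1n.
  by lra.
apply: (@le_trans _ _ 0).
  by have : a.+1%:R <= b%:R :> R by [rewrite ler_nat]; rewrite -natr1; lra.
by rewrite mulr_ge0 // exprn_ge0 // ?invr_ge0 ler0n.
Qed.

Lemma gain_ge x y t :
  (forall i, (l.-1 <= x i <= l.+1)%N) -> (forall i, (l.-1 <= y i <= l.+1)%N) ->
  1 + t%:R - 2 ^+ t * gain_weight x y <= gain l m (fun x => (L x y)%:R) x :> R.
Proof.
move=> xl yl.
pose mx k := mixed l (x k.*2) (x k.*2.+1) : nat.
pose d k := ((L (equalize l x k) y).+1 - L x y)%N.
have -> : gain_weight x y = 2 ^+ (\sum_(k < m) mx k) * 2^-1 ^+ (\sum_(k < m) mx k * d k).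
  rewrite !expr_sum -big_split /=; apply: eq_bigr => k _; rewrite /mx.
  by case: ifP => _; rewrite ?mul1n ?mul0n ?expr0 ?mulr1 // expr1.
have -> : gain l m (fun x => (L x y)%:R) x =
    (\sum_(k < m) mx k * d k)%N%:R - (\sum_(k < m) mx k)%N%:R :> R.
  rewrite !natr_sum -sumrB; apply: eq_bigr => k _; rewrite /mx.
  case: ifP => [mix|_]; last by rewrite subrr.
  rewrite mul1n /d natrB ?equalize_lcs_le // -[(L (equalize _ _ _) _).+1%:R]natr1 /=; ring.
rewrite mulrA -exprD; have := pow2_bernoulli (t + \sum_(k < m) mx k) (\sum_(k < m) mx k * d k).
by rewrite natrD; lra.
Qed.

(* The sum over [G] and [H] is a union bound over all possible alignments; it  *)
(* costs a factor [1 + z] per block, where [z = 2^-11] penalises each skipped block. *)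
Lemma means_gain_weight_le e q :
  (n <= q * l.-1)%N -> (q + m.*2 <= n)%N ->
  (forall x y, wdom (lengths l) l n x -> wdom (lengths l) l n y ->
     (n < L x y + l.-1 * e.+1)%N) ->
  means l n (fun y => means l n (fun x => gain_weight x y)) <=
  4 ^+ (2 + 4 * e) * 2 ^+ (11 * (2 + 4 * e)) * 2 ^+ (11 * (q + (2 + 4 * e) - m.*2)) *
  (1 + 2^-1 ^+ 11) ^+ (m.*2 + q) * (79 / 81) ^+ m.
Proof.
move=> nq qmn loss; set B := (2 + 4 * e)%N; set z : R := 2^-1 ^+ 11.
have l_gt0 := ltnW l_gt1.
have z_gt0 : 0 < z by rewrite exprn_gt0 // invr_gt0 ltr0n.
pose bits := [:: true; false].
pose P g H x y := \prod_(k < m) pair_weight R l (x k.*2) (x k.*2.+1)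
          (y (encode m.*2 q g H k.*2)) (y (encode m.*2 q g H k.*2.+1)).
pose pen k (g : nat -> bool) : R := \prod_(i < k) z ^+ (~~ g i).
(* [4 ^+ B] pays for the pairs with a bad block; the other two powers undo the penalties [pen] of
   the skipped blocks of X and of Y. *)
pose C : R := 4 ^+ B * 2 ^+ (11 * B) * 2 ^+ (11 * (q + B - m.*2)).
have C_ge0 : 0 <= C by apply: mulr_ge0; first apply: mulr_ge0; exact: exprn_ge0.
have P_ge0 g H x y : 0 <= P g H x y.
  by apply: prodr_ge0 => k _; apply: le_trans (pair_weight_ge _ l_gt0 _ _ _ _); lra.
have pen_ge0 k g : 0 <= pen k g by apply: prodr_ge0 => i _; rewrite exprn_ge0 // ltW.
have pen_ge k (g : nat -> bool) a :
    (\sum_(i < k) ~~ g i <= a)%N -> 1 <= 2 ^+ (11 * a) * pen k g.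
  move=> le_a; rewrite /pen -expr_sum /z -exprM exprVn ler_pdivlMr ?exprn_gt0 //.
  by rewrite mul1r ler_eXn2l ?ltr1n // leq_mul.
apply: (@le_trans _ _ (means l n (fun y => means l n (fun x => C *
   wsums 1 bits false m.*2 (fun g => wsums 1 bits false q (fun H =>
     pen m.*2 g * pen q H * P g H x y)))))).
  apply: ler_wsums => [|y yd]; first exact: mean_weight_ge0.
  apply: ler_wsums => [|x xd]; first exact: mean_weight_ge0.
  have [G [H [Gm Hq badG badH le_V]]] :=
    gain_weight_le (lengths_bounds l_gt0 xd) (lengths_bounds l_gt0 yd) (loss x y xd yd) nq.
  apply: le_trans le_V _.
  have Gd : wdom bits false m.*2 G.
    split=> i im; first by case: (G i); rewrite !inE.
    by apply/negbTE/negP => /Gm; rewrite ltnNge im.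
  have Hd : wdom bits false q H.
    split=> i im; first by case: (H i); rewrite !inE.
    by apply/negbTE/negP => /Hq; rewrite ltnNge im.
  have F_ge0 g H' : 0 <= pen m.*2 g * pen q H' * P g H' x y by rewrite !mulr_ge0.
  have := wsums_ge (F := fun g => wsums 1 bits false q (fun H =>
     pen m.*2 g * pen q H * P g H x y)) erefl _ Gd.
  have := wsums_ge (F := fun H => pen m.*2 G * pen q H * P G H x y) erefl (F_ge0 G) Hd.
  set S1 := wsums _ _ _ _ _; set S2 := wsums _ _ _ _ _ => le1 le2.
  have {}le2 : S1 <= S2.
    apply: le2 => g; rewrite -(wsums0 (1 : R) bits false q); apply: ler_wsums => // H' _.
  have := pen_ge _ _ _ badG.
  have le_H : (\sum_(j < q) ~~ H j <= q + B - m.*2)%N by lia.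
  have := pen_ge _ _ _ le_H.
  rewrite -/B -/(P G H x y) => ge1 ge2.
  apply: le_trans (ler_wpM2l C_ge0 (le_trans le1 le2)).
  have -> : C * (pen m.*2 G * pen q H * P G H x y) = 4 ^+ B *
      ((2 ^+ (11 * B) * pen m.*2 G) * (2 ^+ (11 * (q + B - m.*2)) * pen q H) * P G H x y).
    by rewrite /C; ring.
  rewrite ler_wpM2l ?exprn_ge0 // -[leLHS]mul1r ler_wpM2r //.
  by rewrite -[leLHS]mulr1 ler_pM.
(* For fixed [g] and [H] the pairing no longer depends on the strings, so once the sums are
   exchanged [means_pair_weight] applies. *)
have -> : means l n (fun y => means l n (fun x => C *
   wsums 1 bits false m.*2 (fun g => wsums 1 bits false q (fun H =>
     pen m.*2 g * pen q H * P g H x y)))) =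
  C * wsums 1 bits false m.*2 (fun g => wsums 1 bits false q (fun H =>
     pen m.*2 g * pen q H * (79 / 81) ^+ m)).
  rewrite -wsumsZ; transitivity (means l n (fun y => wsums 1 bits false m.*2 (fun g =>
    means l n (fun x => C * wsums 1 bits false q (fun H => pen m.*2 g * pen q H * P g H x y))))).
    apply: eq_wsums => y _; rewrite -[RHS]wsums_swap.
    by apply: eq_wsums => x _; rewrite -wsumsZ.
  rewrite {1}/means wsums_swap; apply: eq_wsums => g _.
  rewrite -wsumsZ; transitivity (means l n (fun y => wsums 1 bits false q (fun H =>
    means l n (fun x => C * (pen m.*2 g * pen q H * P g H x y))))).
    apply: eq_wsums => y _; rewrite -[RHS]wsums_swap.
    by apply: eq_wsums => x _; rewrite -wsumsZ.
  rewrite {1}/means wsums_swap; apply: eq_wsums => H _.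
  rewrite -(means_pair_weight R l_gt0 (n := n) (h := encode m.*2 q g H)).
  - rewrite /means -!wsumsZ; apply: eq_wsums => y _; rewrite -!wsumsZ.
    by apply: eq_wsums.
  - by lia.
  - move=> i im; have [->|[_ _ lt_q _]] := encode_cases m.*2 q g H i; first by lia.
    by apply: leq_trans lt_q _; lia.
  - exact: encode_inj.
rewrite -/C -mulrA ler_wpM2l // exprD.
have wsum_pen : wsum 1 bits (fun b : bool => z ^+ (~~ b)) = 1 + z.
  by rewrite /wsum !big_cons big_nil expr0 expr1 addr0 mul1r.
have pen_sum k : wsums 1 bits false k (pen k) = (1 + z) ^+ k.
  rewrite (wsums_prod _ _ _ k (fun _ b => z ^+ (~~ b))).
  by rewrite wsum_pen prodr_const card_ord.
rewrite -[X in _ <= X * _ * _]pen_sum -[X in _ <= _ * X * _]pen_sum.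
rewrite le_eqVlt; apply/orP; left; apply/eqP.
rewrite -mulrA [RHS]mulrC -wsumsZ; apply: eq_wsums => g _.
by rewrite -mulrA [RHS]mulrC -wsumsZ; apply: eq_wsums => H _; ring.
Qed.

End Drift.

(** * Variance bounds in the product model *)

(* As [n - L_n <= 481 * p], at most [e] blocks are skipped for each reason, and [q] bounds  *)
(* the number of blocks of Y; the last inequality controls the cost of the union bound.     *)
Lemma alignment_parameters l n p :
  (200 * 1000 <= l)%N -> (241 * l + 4000 <= p)%N ->
  (240 * p * l.+1 <= n)%N -> (n < 240 * p.+1 * l.+1)%N ->
  exists e q, [/\ (n < (240 * p).-1 * l.-1 + l.-1 * e.+1)%N,
    (n <= q * l.-1)%N, (q + 240 * p <= n)%N, (240 * p + q <= 600 * p)%N &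
    (13 * (2 + 4 * e) + 11 * (q + (2 + 4 * e) - 240 * p) <= p)%N].
Proof.
move=> l_ge p_ge n_ge n_lt; set a := l.-1.
have a_ge : (199 * 1000 <= a)%N by rewrite /a; lia.
have a_gt0 : (0 < a)%N by lia.
have El : l.+1 = (a + 2)%N by rewrite /a; lia.
pose e := ((481 * p) %/ a)%N; pose q := (n %/ a).+1.
have e_gt : (481 * p < a * e.+1)%N by rewrite [(a * _)%N]mulnC; exact: ltn_ceil.
have e_le : (a * e <= 481 * p)%N by rewrite [(a * _)%N]mulnC; exact: leq_divM.
have q_gt : (n < q * a)%N by exact: ltn_ceil.
have q_le : (q * a <= n + a)%N by rewrite /q mulSn addnC leq_add2r leq_divM.
have e_le' : (199 * 1000 * e <= 481 * p)%N by apply: leq_trans e_le; rewrite leq_mul2r a_ge orbT.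
have En : (240 * p.+1 * l.+1 = 240 * (p * a) + 480 * p + 240 * a + 480)%N by rewrite El; ring.
have q_bound : (199 * 1000 * (q - (240 * p + 241)) <= 480 * p + 480)%N.
  apply: (@leq_trans (a * (q - (240 * p + 241)))%N); first by rewrite leq_mul2r a_ge orbT.
  by rewrite mulnBr mulnDr !(mulnC a) -mulnA; lia.
exists e, q; split.
- have : ((240 * p).-1 * a + a = 240 * (p * a))%N by rewrite -mulSnr prednK; [ring | lia].
  by move: e_gt n_lt; rewrite En; lia.
- exact: ltnW.
- have : (600 * p <= 240 * p * l.+1)%N.
    by apply: (@leq_trans (240 * p * 3)%N); [lia | rewrite leq_mul2l; lia].
  by lia.
- by lia.
- by lia.
Qed.

Section Moments.
Variable R : realFieldType.

Lemma bernoulli (x : R) k : -1 <= x -> 1 + k%:R * x <= (1 + x) ^+ k.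
Proof.
move=> x_ge; elim: k => [|k IH]; first by rewrite expr0 mul0r addr0.
rewrite exprSr -natr1; have k0 : 0 <= k%:R :> R by rewrite ler0n.
have : (1 + k%:R * x) * (1 + x) <= (1 + x) ^+ k * (1 + x) by rewrite ler_wpM2r //; lra.
by have := mulr_ge0 k0 (sqr_ge0 x); lra.
Qed.

(** Bernoulli for the inverse 1 - 1/2049, as 600/2049 is below 1/2. *)
Lemma skip_entropy_le : (1 + 2^-1 ^+ 11 : R) ^+ 600 <= 2.
Proof.
set z := 2^-1 ^+ 11.
have Ez : 1 + z = (1 + - (2049%:R)^-1)^-1.
  have -> : z = 2048%:R^-1 by rewrite /z exprVn -natrX.
  by field.
have ge_half : 2^-1 <= (1 - (2049%:R)^-1) ^+ 600 :> R.
  have x_ge : -1 <= - (2049%:R)^-1 :> R by lra.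
  by apply: le_trans (bernoulli 600 x_ge); lra.
move: ge_half; rewrite Ez exprVn; move: (_ ^+ 600) => A A_ge.
by rewrite -[leRHS]invrK lef_pV2 ?posrE //; lra.
Qed.

(** Bernoulli gives (1 + 2/79)^40 >= 1 + 80/79 >= 2; then cube. *)
Lemma pair_decay_le : (79 / 81 : R) ^+ 120 <= 8^-1.
Proof.
have le40 : (79 / 81 : R) ^+ 40 <= 2^-1.
  have ge2 : 2 <= (1 + 2 / 79 : R) ^+ 40.
    by apply: le_trans (bernoulli _ _); lra.
  have -> : 79 / 81 = (1 + 2 / 79)^-1 :> R by field.
  by rewrite exprVn lef_pV2 ?posrE //; exact: lt_le_trans ge2.
rewrite (_ : 120 = 40 * 3)%N // exprM (_ : 8^-1 = 2^-1 ^+ 3); last by field.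
by rewrite lerXn2r // nnegrE ?exprn_ge0 ?invr_ge0 //; lra.
Qed.

Variables (l n : nat).
Local Notation F s s' := (fun x y => (block_lcs s s' n x y)%:R : R).

(** With [120 * p] pairs, the mean of 2^-D is at most 2^p (skipped blocks) times 2^p
    ([skip_entropy_le]) times 8^-p ([pair_decay_le]), that is 2^-p. Averaging [gain_ge] with [t = p]
    concludes. *)
Lemma means_gain_lower p s s' :
  (200 * 1000 <= l)%N -> (241 * l + 4000 <= p)%N ->
  (240 * p * l.+1 <= n)%N -> (n < 240 * p.+1 * l.+1)%N ->
  p%:R <= means l n (fun y => means l n (gain l (120 * p) (fun x => F s s' x y))).
Proof.
move=> l_ge p_ge n_ge n_lt.
have [e [q [loss nq qmn qle params]]] := alignment_parameters l_ge p_ge n_ge n_lt.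
have l_gt1 : (1 < l)%N by lia.
set m := (120 * p)%N; have Em : m.*2 = (240 * p)%N by rewrite /m -mul2n mulnA.
have mn : (m.*2 * l.+1 <= n)%N by rewrite Em.
have loss' x y : wdom (lengths l) l n x -> wdom (lengths l) l n y ->
    (n < block_lcs s s' n x y + l.-1 * e.+1)%N.
  move=> xd yd; apply: leq_trans loss _; rewrite leq_add2r.
  have l_gt0 := ltnW l_gt1; have xl := lengths_bounds l_gt0 xd.
  have yl := lengths_bounds l_gt0 yd; apply: (@block_string_lcs_lb l) => //; first by lia.
  by rewrite prednK //; lia.
have W_le : 2 ^+ p * means l n (fun y => means l n (fun x => gain_weight R l s s' n m x y)) <= 1.
  have := means_gain_weight_le R l_gt1 mn nq _ loss'; rewrite Em => /(_ qmn).
  set W := means _ _ _ => W_le.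
  have pow4 : 4 ^+ (2 + 4 * e) = 2 ^+ (2 * (2 + 4 * e)) :> R by rewrite exprM; congr (_ ^+ _); ring.
  have c_le : 4 ^+ (2 + 4 * e) * 2 ^+ (11 * (2 + 4 * e)) *
      2 ^+ (11 * (q + (2 + 4 * e) - 240 * p)) <= 2 ^+ p :> R.
    by rewrite pow4 -!exprD ler_eXn2l ?ltr1n //; lia.
  have z_ge0 : 0 <= 2^-1 ^+ 11 :> R by rewrite exprn_ge0 // invr_ge0.
  have z_le : (1 + 2^-1 ^+ 11) ^+ (240 * p + q) <= 2 ^+ p :> R.
    apply: (@le_trans _ _ ((1 + 2^-1 ^+ 11) ^+ (600 * p))).
      by rewrite ler_weXn2l // lerDl.
    by rewrite exprM lerXn2r ?skip_entropy_le // nnegrE ?exprn_ge0 // addr_ge0.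
  have d_ge0 : 0 <= 79 / 81 :> R by rewrite divr_ge0.
  have d_le : (79 / 81) ^+ m <= 8^-1 ^+ p :> R.
    by rewrite /m exprM lerXn2r ?pair_decay_le // nnegrE ?exprn_ge0 ?invr_ge0.
  have {}W_le : W <= 2 ^+ p * 2 ^+ p * (8^-1) ^+ p.
    have zz_ge0 : 0 <= (1 + 2^-1 ^+ 11) ^+ (240 * p + q) :> R.
      by apply: exprn_ge0; rewrite addr_ge0.
    have c_ge0 : 0 <= 4 ^+ (2 + 4 * e) * 2 ^+ (11 * (2 + 4 * e)) *
        2 ^+ (11 * (q + (2 + 4 * e) - 240 * p)) :> R.
      by apply: mulr_ge0; first apply: mulr_ge0; exact: exprn_ge0.
    apply: le_trans W_le _; apply: ler_pM d_le; [|exact: exprn_ge0 |exact: ler_pM z_le].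
    exact: mulr_ge0.
  apply: le_trans (ler_wpM2l _ W_le) _; first exact: exprn_ge0.
  rewrite -!exprMn (_ : _ * _ = 1); first by rewrite expr1n.
  by field.
apply: (@le_trans _ _ (means l n (fun y => means l n (fun x =>
  1 + p%:R - 2 ^+ p * gain_weight R l s s' n m x y)))).
  have norm := mean_norm R l.
  have -> : means l n (fun y => means l n (fun x =>
     1 + p%:R - 2 ^+ p * gain_weight R l s s' n m x y)) =
     1 + p%:R - 2 ^+ p * means l n (fun y => means l n (fun x => gain_weight R l s s' n m x y)).
    rewrite -wsumsZ -[X in _ = X - _](wsums_cst l norm n) -wsumsB.
    by apply: eq_wsums => y _; rewrite /means wsumsB wsums_cst // wsumsZ.
  by lra.
apply: ler_wsums => [|y yd]; first exact: mean_weight_ge0.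
apply: ler_wsums => [|x xd]; first exact: mean_weight_ge0.
by apply: gain_ge => //; [apply: lengths_bounds xd | apply: lengths_bounds yd]; lia.
Qed.

Lemma means_sqr_lower p s s' (c : R) :
  (200 * 1000 <= l)%N -> (241 * l + 4000 <= p)%N ->
  (240 * p * l.+1 <= n)%N -> (n < 240 * p.+1 * l.+1)%N ->
  p%:R / 80%:R <= means l n (fun y => means l n (fun x => (F s s' x y - c) ^+ 2)).
Proof.
move=> l_ge p_ge n_ge n_lt; have := means_gain_lower s s' l_ge p_ge n_ge n_lt.
set D := means _ _ _ => D_ge.
(* The mean square of the test function is 80 p, so lam = 1/80 maximises 2 lam p - 80 lam^2 p, with
   value p/80. *)
apply: (@le_trans _ _ (means l n (fun y => 2 * 80%:R^-1 *
   means l n (gain l (120 * p) (fun x => F s s' x y)) -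
   80%:R^-1 ^+ 2 * (2 / 3 * (120 * p)%:R)))).
  rewrite /means wsumsB (wsums_cst _ (mean_norm R l)) wsumsZ -!/(means _ _ _) -/D.
  rewrite natrM; have : 0 <= p%:R :> R by exact: ler0n.
  by lra.
apply: ler_wsums => [|y yd]; first exact: mean_weight_ge0.
apply: means_sqr_ge; first by lia.
have : (2 * (120 * p) <= 240 * p * l.+1)%N by rewrite mulnA leq_pmulr.
by rewrite -mul2n; lia.
Qed.

Lemma means_sqr_expand (G : (nat -> nat) -> (nat -> nat) -> R) (c : R) :
  means l n (fun y => means l n (fun x => (G x y - c) ^+ 2)) =
  means l n (fun y => means l n (fun x => G x y ^+ 2)) -
  2 * c * means l n (fun y => means l n (fun x => G x y)) + c ^+ 2.
Proof.
have norm := mean_norm R l.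
transitivity (means l n (fun y => - (2 * c) * means l n (fun x => G x y) +
    (means l n (fun x => G x y ^+ 2) + c ^+ 2))).
  apply: eq_wsums => y _; rewrite -(wsums_cst l norm n (c ^+ 2)).
  rewrite /means -wsumsD -wsums_lin; apply: eq_wsums => x _; ring.
by rewrite /means wsums_lin wsumsD wsums_cst //; ring.
Qed.

Lemma block_lcsC s s' x y : block_lcs s s' n x y = block_lcs s' s n y x.
Proof. exact: lcs_lengthC. Qed.

Lemma block_lcs_lipschitz s s' x x' y k :
  (n <= lcs_length (block_string s x n) (block_string s' x' n) + k)%N ->
  forall t, `|F s' t x' y - F s t x y| <= k%:R.
Proof.
set u := block_string s x n; set u' := block_string s' x' n => le_k t.
have := lcs_length_triangle u u' (block_string t y n).
have := lcs_length_triangle u' u (block_string t y n).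
rewrite [lcs_length u' u]lcs_lengthC !size_block_string.
rewrite -/(block_lcs s t n x y) -/(block_lcs s' t n x' y) => le1 le2.
have {}le1 : (block_lcs s' t n x' y)%:R <= (block_lcs s t n x y)%:R + k%:R :> R.
  by rewrite -natrD ler_nat; lia.
have {}le2 : (block_lcs s t n x y)%:R <= (block_lcs s' t n x' y)%:R + k%:R :> R.
  by rewrite -natrD ler_nat; lia.
by rewrite ler_norml; lra.
Qed.

(** * Upper bound on the mean square deviation *)

Section LargeLength.
Hypothesis l_gt1 : (1 < l)%N.

Lemma block_lcs_upd s s' x y i a : wdom (lengths l) l n x -> a \in lengths l ->
  `|F s s' (upd x i a) y - F s s' x y| <= 2.
Proof.
move=> xd aA; apply: block_lcs_lipschitz.
have xl := lengths_bounds (ltnW l_gt1) xd.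
have al : (l.-1 <= a <= l.+1)%N.
  by move: aA; rewrite !inE => /or3P[] /eqP ->; lia.
have x0 j : (0 < x j)%N by have := xl j; lia.
have u0 j : (0 < upd x i a j)%N by rewrite /upd; case: eqP => // _; lia.
have ux j : j != i -> upd x i a j = x j by rewrite /upd => /negbTE ->.
have ui : upd x i a i = a by rewrite /upd eqxx.
have := xl i; case: (leqP (x i) a) => xa xli.
  apply: (@block_string_update_lcs _ _ _ _ i) => // [j ji|]; first by rewrite ux.
  by rewrite ui; lia.
rewrite lcs_lengthC; apply: (@block_string_update_lcs _ _ _ _ i) => //.
by rewrite ui; lia.
Qed.

(** Total variance with respect to [y]: the mean conditional variance and the variance of the
    conditional mean are each at most [n * 2 ^+ 2]. *)
Lemma means_var_upper s s' :
  means l n (fun y => means l n (fun x => F s s' x y ^+ 2)) -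
  means l n (fun y => means l n (fun x => F s s' x y)) ^+ 2 <= 8 * n%:R.
Proof.
have norm := mean_norm R l; have w0 := mean_weight_ge0 R; have lA := l_in_lengths l.
have le1 : means l n (fun y => means l n (fun x => F s s' x y ^+ 2) -
    means l n (fun x => F s s' x y) ^+ 2) <= n%:R * 2 ^+ 2.
  rewrite -[leRHS](wsums_cst l norm n); apply: ler_wsums => // y yd.
  by apply: wsums_var_le => // x i a xd _ aA; exact: block_lcs_upd.
have le2 : means l n (fun y => means l n (fun x => F s s' x y) ^+ 2) -
    means l n (fun y => means l n (fun x => F s s' x y)) ^+ 2 <= n%:R * 2 ^+ 2.
  apply: wsums_var_le => // y i a yd _ aA; apply: ler_norm_wsums => // x xd.
  by have := block_lcs_upd s' s x i yd aA; rewrite !(block_lcsC s').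
move: le1 le2; rewrite {1}/means wsumsB -!/(means _ _ _).
by set a := means _ _ _; set b := means _ _ _; set c := means _ _ _ ^+ 2; lra.
Qed.

(* Prepending a block to [x] flips the first symbol at a bounded cost. *)
Lemma means_flip s s' y (c : R) :
  means l n (fun x => (F (~~ s) s' x y - c) ^+ 2) <=
  2 * means l n (fun x => (F s s' x y - c) ^+ 2) + 2 * l.+1%:R ^+ 2.
Proof.
have norm := mean_norm R l; have w0 := mean_weight_ge0 R.
have E : means l n (fun x => (F s s' x y - c) ^+ 2) =
         means l n.+1 (fun x => (F s s' x y - c) ^+ 2).
  apply/esym/wsumsS_ext => // x x' xx'.
  by rewrite /block_lcs (@block_string_ext x x').
rewrite E /means -wsumsZ -[X in _ + X](wsums_cst l norm n.+1) -wsumsD.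
rewrite /= -[leLHS](wsum_cst norm); apply: ler_wsum => // a aA.
apply: ler_wsums => // x xd.
have xl := lengths_bounds (ltnW l_gt1) xd.
have al : (l.-1 <= a <= l.+1)%N.
  by move: aA; rewrite !inE => /or3P[] /eqP ->; lia.
have u0 j : (0 < scons a x j)%N by case: j => [|j] /=; [|have := xl j]; lia.
have : (n <= lcs_length (block_string s (scons a x) n) (block_string (~~ s) x n) + l.+1)%N.
  case: (leqP n a) => [na|an]; first by lia.
  have En : n = (scons a x 0 + (n - a))%N by rewrite /=; lia.
  rewrite [X in block_string s _ X]En block_string_cons //=.
  apply: (@leq_trans (n - a + l.+1)%N); [by lia | rewrite leq_add2r].
  apply: leq_trans (lcs_length_subseq (suffix_subseq _ _) (subseq_refl _)).
  rewrite -{1}(size_block_string x (~~ s) (n - a)); apply: common_prefix_lcs.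
    exact: prefix_refl.
  by apply: prefix_block_string; lia.
move=> le_n; have := block_lcs_lipschitz y le_n s'.
move: (F s s' (scons a x) y) (F (~~ s) s' x y) l.+1%:R => u v k.
rewrite ler_norml => /andP[le1 le2].
(* This is (v - u)^2 <= k^2; the next square gives (v - c)^2 <= 2 (u - c)^2 + 2 (v - u)^2. *)
have : 0 <= (k - (v - u)) * (k + (v - u)) by apply: mulr_ge0; lra.
by have := sqr_ge0 (v - u - (u - c)); lra.
Qed.

(** One centre [c] serves all first symbols. Each flip turns a bound B into 2 B + 2 n, so 8 n
    becomes 18 n and then 38 n. *)
Lemma means_sqr_upper s s' c :
  c = means l n (fun y => means l n (fun x => F false false x y)) ->
  (l.+1 ^ 2 <= n)%N ->
  means l n (fun y => means l n (fun x => (F s s' x y - c) ^+ 2)) <= 38 * n%:R.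
Proof.
move=> Ec n_ge; have norm := mean_norm R l; have w0 := mean_weight_ge0 R.
pose Q t t' := means l n (fun y => means l n (fun x => (F t t' x y - c) ^+ 2)).
have Q_flip t t' : Q (~~ t) t' <= 2 * Q t t' + 2 * l.+1%:R ^+ 2.
  rewrite /Q {1 3}/means -wsumsZ -[X in _ + X](wsums_cst l norm n) -wsumsD.
  by apply: ler_wsums => // y _; exact: means_flip.
have QC t t' : Q t t' = Q t' t.
  rewrite /Q /means wsums_swap; apply: eq_wsums => y _; apply: eq_wsums => x _.
  by rewrite block_lcsC.
have Q0 : Q false false <= 8 * n%:R.
  apply: le_trans (means_var_upper false false); rewrite /Q.
  by rewrite means_sqr_expand -Ec; lra.
have k_le : l.+1%:R ^+ 2 <= n%:R :> R by rewrite -natrX ler_nat.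
have Q1 := Q_flip false false; have Q2 := Q_flip false true.
have Q3 := QC false true.
have n0 : 0 <= n%:R :> R by rewrite ler0n.
by rewrite -/(Q s s'); case: s; case: s'; rewrite /= in Q1 Q2 *; lra.
Qed.

End LargeLength.
End Moments.

(** * From the probability space to the product model *)

Lemma wsums_scale (R : realFieldType) (T : eqType) (w : R) (A : seq T) d n F :
  wsums w A d n F = w ^+ n * wsums 1 A d n F.
Proof.
elim: n F => [|n IH] F /=; first by rewrite expr0 mul1r.
rewrite /wsum mul1r exprS -mulrA; congr (w * _); rewrite mulr_sumr.
by apply: eq_bigr => a _; rewrite IH.
Qed.

Lemma wsums_delta (R : realFieldType) (T : eqType) (A : seq T) d n
    (F : (nat -> T) -> R) (x0 : nat -> T) : uniq A ->
  (forall i, (i < n)%N -> x0 i \in A) ->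
  (forall x, (forall i, (i < n)%N -> x i = x0 i) -> F x = F x0) ->
  wsums 1 A d n (fun x => F x * \prod_(i < n) (x0 i == x i)%:R) = F x0.
Proof.
move=> uA; elim: n F x0 => [|n IH] F x0 x0A extF /=.
  by rewrite big_ord0 mulr1; apply: extF.
rewrite /wsum mul1r (big_rem (x0 0%N)) /=; last exact: x0A.
rewrite [X in _ + X]big1_seq ?addr0; last first.
  move=> a /= aA; rewrite -[RHS](wsums0 (1 : R) A d n); apply: eq_wsums => x _.
  rewrite big_ord_recl /= (_ : _ == a = false) ?mul0r ?mulr0 //; apply/negbTE/eqP => E.
  by move: aA; rewrite -E mem_rem_uniqF.
transitivity (F (scons (x0 0%N) (fun i => x0 i.+1))); last by rewrite scons_eta.
rewrite -(IH (fun x => F (scons (x0 0%N) x)) (fun i => x0 i.+1)).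
- by apply: eq_wsums => x _; rewrite big_ord_recl /= eqxx mul1r.
- by move=> i i_n; exact: x0A.
move=> x xx0; rewrite [RHS](_ : _ = F x0) ?scons_eta //.
by apply: extF => -[|i] //= /xx0.
Qed.

Lemma wsums_delta0 (R : realFieldType) (T : eqType) (A : seq T) d n
    (F : (nat -> T) -> R) (x0 : nat -> T) i : (i < n)%N -> x0 i \notin A ->
  wsums 1 A d n (fun x => F x * \prod_(i < n) (x0 i == x i)%:R) = 0.
Proof.
move=> i_n x0A; rewrite -[RHS](wsums0 (1 : R) A d n); apply: eq_wsums => x [xA _].
rewrite (bigD1 (Ordinal i_n)) //= (_ : _ == _ = false) ?mul0r ?mulr0 //.
by apply/negbTE/eqP => E; move: x0A; rewrite E xA.
Qed.

Section Link.
Local Open Scope classical_set_scope.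
Context {d : measure_display} {T : measurableType d} {R : realType}.
Variable P : probability T R.

Definition has_mean (X : T -> R) (r : R) := X \in Lfun P 1 /\ ('E_P[X] = r%:E)%E.

Lemma has_mean_lin X Y r q c :
  has_mean X r -> has_mean Y q -> has_mean (fun t => c * X t + Y t) (c * r + q).
Proof.
move=> [LX EX] [LY EY].
have LcX : c \o* X \in Lfun P 1.
  by rewrite (_ : c \o* X = c *: X); [exact: rpredZ | apply/funext => t; rewrite /= mulrC].
have -> : (fun t => c * X t + Y t) = (c \o* X) \+ Y.
  by apply/funext => t; rewrite /= mulrC.
split; first by rewrite (_ : _ \+ _ = (c \o* X) + Y) // rpredD.
by rewrite expectationD // expectationZl // EX EY.
Qed.

Lemma has_mean0 : has_mean (fun=> 0) 0.
Proof. by split; [exact: (Lfun_cst P 0 1) | exact: expectation_cst]. Qed.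

Lemma has_mean_wsum (A : eqType) (w : R) (s : seq A) (X : A -> T -> R) r :
  (forall a, has_mean (X a) (r a)) ->
  has_mean (fun t => wsum w s (fun a => X a t)) (wsum w s r).
Proof.
move=> Xr; suff : has_mean (fun t => \sum_(a <- s) X a t) (\sum_(a <- s) r a).
  move=> h; have := has_mean_lin w h has_mean0; rewrite addr0.
  by under eq_fun do rewrite addr0.
elim: s => [|a s IH].
  by rewrite big_nil; under eq_fun do rewrite big_nil; exact: has_mean0.
rewrite big_cons; under eq_fun do rewrite big_cons.
by have := has_mean_lin 1 (Xr a) IH; rewrite mul1r; under eq_fun do rewrite mul1r.
Qed.

Lemma has_mean_wsums (A : eqType) (w : R) (s : seq A) a0 n (X : (nat -> A) -> T -> R) r :
  (forall x, wdom s a0 n x -> has_mean (X x) (r x)) ->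
  has_mean (fun t => wsums w s a0 n (fun x => X x t)) (wsums w s a0 n r).
Proof.
elim: n X r => [|n IH] X r Xr /=; first by apply: Xr; split.
pose X' a t := if a \in s then wsums w s a0 n (fun x => X (scons a x) t) else 0.
pose r' a := if a \in s then wsums w s a0 n (fun x => r (scons a x)) else 0.
have := @has_mean_wsum _ w s X' r'.
have -> : wsum w s r' = wsum w s (fun a => wsums w s a0 n (fun x => r (scons a x))).
  by apply: eq_wsum => a; rewrite /r' => ->.
have -> : (fun t => wsum w s (X'^~ t)) =
    (fun t => wsum w s (fun a => wsums w s a0 n (fun x => X (scons a x) t))).
  by apply/funext => t; apply: eq_wsum => a; rewrite /X' => ->.
apply => a; rewrite /X' /r'; case: ifP => aA; last exact: has_mean0.
by apply: IH => x xd; apply: Xr; exact: wdom_scons.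
Qed.

Lemma has_mean_indic (A : set T) r : measurable A -> P A = r%:E -> has_mean \1_A r.
Proof.
move=> mA PA; split; last by rewrite expectation_indic.
by apply/Lfun1_integrable; exact: integrable_indic.
Qed.

Variables (BX BY : nat -> {RV P >-> nat}) (sX sY : {RV P >-> bool}).
Variables (l n : nat).
Hypothesis l_gt0 : (0 < l)%N.
Hypothesis model : block_model BX BY sX sY l.

Definition atom s s' (x y : nat -> nat) : set T :=
  [set t | [/\ sX t = s, sY t = s' &
    forall i, (i < n)%N -> BX i t = x i /\ BY i t = y i]].

Let index : choiceType := ((nat + nat) + bool)%type.

Let indices : seq index := [seq inl (inl i) | i <- iota 0 n] ++
  [seq inl (inr i) | i <- iota 0 n] ++ [:: inr false; inr true].

Let event s s' (x y : nat -> nat) (i : index) : set T :=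
  match i with
  | inl (inl j) => BX j @^-1` [set x j]
  | inl (inr j) => BY j @^-1` [set y j]
  | inr false => sX @^-1` [set s]
  | inr true => sY @^-1` [set s']
  end.

Let eventP s s' x y i : model_sigma BX BY sX sY i (event s s' x y i).
Proof.
by case: i => [[j|j]|[]] /=; [exists [set x j]|exists [set y j]|exists [set s']|exists [set s]];
  rewrite // ?setTI.
Qed.

Let event_measurable s s' x y i : measurable (event s s' x y i).
Proof.
by case: i => [[j|j]|[]] /=; rewrite -[X in measurable X]setTI; exact: measurable_funPT.
Qed.

Let atomE s s' x y :
  atom s s' x y = \bigcap_(i in [set` [fset i in indices]%fset]) event s s' x y i.
Proof.
apply/seteqP; split=> t.
  move=> [st s't xyt] i /=; rewrite in_fset !mem_cat => /or3P[].
  - by move=> /mapP[j]; rewrite mem_iota => /andP[_ /xyt[xj _]] ->.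
  - by move=> /mapP[j]; rewrite mem_iota => /andP[_ /xyt[_ yj]] ->.
  - by rewrite !inE => /orP[] /eqP ->.
move=> all_t; have ev i : i \in indices -> event s s' x y i t.
  by move=> i_in; apply: all_t; rewrite /= in_fset.
split.
- by have := ev (inr false); apply; rewrite !mem_cat !inE eqxx !orbT.
- by have := ev (inr true); apply; rewrite !mem_cat !inE eqxx !orbT.
move=> i i_n; split.
- have := ev (inl (inl i)); apply; rewrite !mem_cat; apply/orP; left.
  by apply: map_f; rewrite mem_iota.
have := ev (inl (inr i)); apply; rewrite !mem_cat; apply/orP; right; apply/orP; left.
by apply: map_f; rewrite mem_iota.
Qed.

Lemma measurable_atom s s' x y : measurable (atom s s' x y).
Proof.
rewrite atomE; apply: fin_bigcap_measurable; first exact: finite_fset.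
by move=> i _; exact: event_measurable.
Qed.

Lemma probability_atom s s' x y :
  (forall i, (i < n)%N -> x i \in lengths l) -> (forall i, (i < n)%N -> y i \in lengths l) ->
  (P (atom s s' x y) = ((3%:R^-1) ^+ n * (3%:R^-1) ^+ n * (2^-1 * 2^-1))%:E)%E.
Proof.
move=> xl yl; rewrite atomE (block_model_indep model); last by move=> i _; exact: eventP.
have -> : (\prod_(i <- [fset i in indices]%fset) P (event s s' x y i) =
    \prod_(i <- indices) P (event s s' x y i))%E.
  apply: perm_big; apply: uniq_perm; rewrite ?fset_uniq //.
    rewrite cat_uniq; apply/and3P; split.
    - by rewrite map_inj_uniq ?iota_uniq // => i j [].
    - apply/hasPn => i; rewrite mem_cat => /orP[/mapP[j _ ->]|]; first by apply/negP => /mapP[].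
      by rewrite !inE => /orP[] /eqP ->; apply/negP => /mapP[].
    rewrite cat_uniq; apply/and3P; split => //.
    - by rewrite map_inj_uniq ?iota_uniq // => i j [].
    - by apply/hasPn => i; rewrite !inE => /orP[] /eqP ->; apply/negP => /mapP[].
  by move=> i; rewrite in_fset.
rewrite !big_cat !big_map /= !big_cons big_nil mule1.
have prodX (B : nat -> {RV P >-> nat}) (z : nat -> nat) :
    (forall i, uniform_length l (B i)) -> (forall i, (i < n)%N -> z i \in lengths l) ->
    (\prod_(i <- iota 0 n) P (B i @^-1` [set z i]) = ((3%:R^-1) ^+ n)%:E)%E.
  move=> uB zl; rewrite (eq_big_seq (fun=> (3%:R^-1)%:E)%E); last first.
    by move=> i; rewrite mem_iota => /andP[_ i_n]; apply: uB; exact: zl.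
  by rewrite -{2}(size_iota 0 n) prodEFin big_const_seq count_predT iter_mulr_1.
rewrite (prodX _ _ (block_model_BX model) xl) (prodX _ _ (block_model_BY model) yl).
by rewrite (block_model_sX model) (block_model_sY model) -!EFinM mulrA.
Qed.

Definition observe (U : Type) (G : bool -> bool -> (nat -> nat) -> (nat -> nat) -> U) t :=
  G (sX t) (sY t) (BX ^~ t) (BY ^~ t).

Definition finitary (U : Type) (G : bool -> bool -> (nat -> nat) -> (nat -> nat) -> U) :=
  forall s s' x x' y y', (forall i, (i < n)%N -> x i = x' i) ->
    (forall i, (i < n)%N -> y i = y' i) -> G s s' x y = G s s' x' y'.

Lemma measurable_observe (G : bool -> bool -> (nat -> nat) -> (nat -> nat) -> R) :
  finitary G -> measurable_fun setT (observe G).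
Proof.
move=> finG _ B mB; rewrite setTI.
(* Finite sequences of lengths are countable, so the preimage is a countable union of atoms. *)
pose C := (bool * bool * (seq nat * seq nat))%type.
pose at_ (c : C) := atom c.1.1 c.1.2 (nth 0%N c.2.1) (nth 0%N c.2.2).
pose in_ (c : C) := G c.1.1 c.1.2 (nth 0%N c.2.1) (nth 0%N c.2.2) \in B.
have -> : observe G @^-1` B = \bigcup_(c in setT) (if in_ c then at_ c else set0).
  apply/seteqP; split=> t /=.
    move=> Gt; pose c : C := (sX t, sY t, (mkseq (BX ^~ t) n, mkseq (BY ^~ t) n)).
    exists c => //; rewrite ifT.
      by split=> // i i_n; rewrite !nth_mkseq.
    rewrite /in_ inE (_ : G _ _ _ _ = observe G t) //; apply: finG => i i_n;
      by rewrite nth_mkseq.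
  move=> [c _]; case: ifP => // /[1!inE] Gc [st s't xyt].
  rewrite /observe (_ : G _ _ _ _ = G c.1.1 c.1.2 (nth 0%N c.2.1) (nth 0%N c.2.2)) //.
  by rewrite st s't; apply: finG => i /xyt[].
apply: countable_bigcupT_measurable => [|c]; first exact: countableP.
by case: ifP => _; [exact: measurable_atom | exact: measurable0].
Qed.

Definition model_mean (G : bool -> bool -> (nat -> nat) -> (nat -> nat) -> R) :=
  wsum 2^-1 [:: true; false] (fun s => wsum 2^-1 [:: true; false] (fun s' =>
    means l n (fun y => means l n (fun x => G s s' x y)))).

(** Lengths outside [lengths l] have probability 0 but may occur at some sample points; [ok]
    excludes them. *)
Let ok (x : nat -> nat) := [forall i : 'I_n, x i \in lengths l].

Let ok_ext x x' : (forall i, (i < n)%N -> x i = x' i) -> ok x = ok x'.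
Proof. by move=> xx'; apply: eq_forallb => i; rewrite xx'. Qed.

Let uniq_lengths : uniq (lengths l).
Proof. by rewrite /= !inE !negb_or; lia. Qed.

(** The truncated observable is a finite combination of indicators of atoms, whose probabilities are
    known by independence. *)
Lemma has_mean_observe_ok (G : bool -> bool -> (nat -> nat) -> (nat -> nat) -> R) :
  finitary G ->
  has_mean (observe (fun s s' x y => if ok x && ok y then G s s' x y else 0)) (model_mean G).
Proof.
move=> finG; pose bits := [:: true; false].
pose H t := wsum 1 bits (fun s => wsum 1 bits (fun s' =>
  wsums 1 (lengths l) l n (fun y => wsums 1 (lengths l) l n (fun x =>
    G s s' x y * \1_(atom s s' x y) t)))).
have ->: observe (fun s s' x y => if ok x && ok y then G s s' x y else 0) = H.
  apply/funext => t; rewrite /observe.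
  have atomI s s' x y : \1_(atom s s' x y) t = (sX t == s)%:R * (sY t == s')%:R *
     ((\prod_(i < n) (BX i t == x i)%:R) * (\prod_(i < n) (BY i t == y i)%:R)) :> R.
    rewrite indicE; case: (boolP (t \in atom s s' x y)) => [/[1!inE] [[-> -> xyt]]|nt].
      rewrite !eqxx !big1 ?mulr1 // => i _.
        by have [_ ->] := xyt _ (ltn_ord i); rewrite eqxx.
      by have [-> _] := xyt _ (ltn_ord i); rewrite eqxx.
    apply/esym/eqP; apply: contraNT nt; rewrite !mulf_eq0 !negb_or.
    move=> /andP[/andP[st s't] /andP[/prodf_neq0 xt /prodf_neq0 yt]].
    have bool_neq0 (b : bool) : b%:R != 0 :> R -> b by rewrite pnatr_eq0 eqb0 negbK.
    rewrite inE; split; [exact/eqP/bool_neq0 | exact/eqP/bool_neq0 |].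
    move=> i i_n; split; apply/eqP/bool_neq0; first exact: xt (Ordinal i_n) isT.
    exact: yt (Ordinal i_n) isT.
  have Hs (f : bool -> bool -> R) :
      wsum 1 bits (fun s => wsum 1 bits (fun s' => (sX t == s)%:R * (sY t == s')%:R * f s s')) =
      f (sX t) (sY t).
    rewrite /wsum !big_cons !big_nil /=.
    by case: (sX t); case: (sY t); rewrite /=; ring.
  rewrite /H; transitivity (wsum 1 bits (fun s => wsum 1 bits (fun s' =>
     (sX t == s)%:R * (sY t == s')%:R * (wsums 1 (lengths l) l n (fun y =>
       wsums 1 (lengths l) l n (fun x => G s s' x y * \prod_(i < n) (BX i t == x i)%:R) *
         \prod_(i < n) (BY i t == y i)%:R))))); last first.
    apply: eq_wsum => s _; apply: eq_wsum => s' _; rewrite -wsumsZ; apply: eq_wsums => y _.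
    rewrite mulrCA mulrC -wsumsZ; apply: eq_wsums => x _; rewrite atomI; ring.
  rewrite Hs; case: (boolP (ok (BX ^~ t))) => [/forallP okX|/forallPn[i nX]] /=; last first.
    rewrite -[LHS](wsums0 (1 : R) (lengths l) l n); apply: eq_wsums => y _.
    have /= -> := @wsums_delta0 R _ (lengths l) l n
      (fun x => G (sX t) (sY t) x y) (BX ^~ t) i (ltn_ord i) nX.
    by rewrite mul0r.
  case: (boolP (ok (BY ^~ t))) => [/forallP okY|/forallPn[i nY]] /=; last first.
    by have /= -> := @wsums_delta0 R _ (lengths l) l n _ (BY ^~ t) i (ltn_ord i) nY.
  rewrite (@wsums_delta _ _ _ _ _ _ (BY ^~ t)) //.
  - rewrite (@wsums_delta _ _ _ _ _ _ (BX ^~ t)) //.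
    + by move=> i i_n; exact: (okX (Ordinal i_n)).
    + by move=> x xx; apply: finG.
  - by move=> i i_n; exact: (okY (Ordinal i_n)).
  - by move=> y yy; apply: eq_wsums => x _; congr (_ * _); exact: finG.
have -> : model_mean G = wsum 1 bits (fun s => wsum 1 bits (fun s' =>
  wsums 1 (lengths l) l n (fun y => wsums 1 (lengths l) l n (fun x =>
    G s s' x y * (3%:R^-1 ^+ n * 3%:R^-1 ^+ n * (2^-1 * 2^-1)))))).
  have half f : wsum (2^-1 : R) bits f = wsum 1 bits (fun b => 2^-1 * f b).
    by rewrite wsumZ /wsum mul1r.
  rewrite /model_mean half; apply: eq_wsum => s _; rewrite half -wsumZ.
  apply: eq_wsum => s' _; rewrite /means wsums_scale -!wsumsZ; apply: eq_wsums => y _.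
  by rewrite wsums_scale -!wsumsZ; apply: eq_wsums => x _; ring.
apply: has_mean_wsum => s; apply: has_mean_wsum => s'.
apply: has_mean_wsums => y [yA _]; apply: has_mean_wsums => x [xA _].
have mI : has_mean \1_(atom s s' x y) _ :=
  has_mean_indic (measurable_atom s s' x y) (probability_atom s s' xA yA).
have := has_mean_lin (G s s' x y) mI has_mean0; rewrite addr0.
by under eq_fun do rewrite addr0.
Qed.

Lemma model_mean_cst (c : R) : model_mean (fun _ _ _ _ => c) = c.
Proof.
have half : 2^-1 * (size [:: true; false])%:R = 1 :> R by rewrite mulVf // pnatr_eq0.
rewrite /model_mean -[RHS](wsum_cst half); apply: eq_wsum => s _.
rewrite -[RHS](wsum_cst half); apply: eq_wsum => s' _.
rewrite -[RHS](wsums_cst l (mean_norm R l) n); apply: eq_wsums => y _.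
exact: wsums_cst (mean_norm R l) _ _.
Qed.

(** Applied to the constant 1, [has_mean_observe_ok] shows that [D] has probability 1, so truncation
    does not change the expectation. *)
Lemma expectation_observe (G : bool -> bool -> (nat -> nat) -> (nat -> nat) -> R) :
  finitary G -> ('E_P[observe G] = (model_mean G)%:E)%E.
Proof.
move=> finG; have [LG <-] := has_mean_observe_ok finG.
have finC (c : R) : finitary (fun _ _ _ _ => c) by [].
have fin_ok (G' : bool -> bool -> (nat -> nat) -> (nat -> nat) -> R) : finitary G' ->
    finitary (fun s s' x y => if ok x && ok y then G' s s' x y else 0).
  move=> finG' s s' x x' y y' xx' yy'.
  by rewrite (ok_ext xx') (ok_ext yy') (finG' s s' x x' y y').
pose D : set T := [set t | ok (BX ^~ t) && ok (BY ^~ t)].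
have D1 : \1_D = observe (fun _ _ x y => if ok x && ok y then 1 else 0) :> (T -> R).
  apply/funext => t; rewrite /observe indicE /D; case: ifP => okt.
    by rewrite mem_set.
  by rewrite memNset //= okt.
have mD : measurable D.
  have := measurable_observe (fin_ok _ (finC 1)).
  move=> /(_ measurableT [set 1] (measurable_set1 1)); rewrite setTI -D1.
  rewrite (_ : _ @^-1` _ = D) //; apply/seteqP; split=> t /=.
    by rewrite indicE; case: (boolP (t \in D)) => [/set_mem //|_ /eqP]; rewrite eq_sym oner_eq0.
  by move=> Dt; rewrite indicE mem_set.
have PD : P D = 1%E.
  by rewrite -(expectation_indic P mD) D1; have [_ ->] := has_mean_observe_ok (finC 1);
    rewrite model_mean_cst.
rewrite unlock; apply: ae_eq_integral => //.
- by apply/measurable_EFinP; exact: measurable_observe.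
- by apply/measurable_EFinP; exact/measurable_observe/fin_ok.
exists (~` D); split; first exact: measurableC.
  by have := probability_setC P mD; rewrite PD subee // => ->.
move=> t /= ; apply: contra_not => Dt _; congr EFin.
by rewrite /observe; move: Dt; rewrite /D /= => ->.
Qed.

End Link.

(** * The variance of the LCS length *)

Definition lcs_fun {R : realType} n s s' x y : R := (block_lcs s s' n x y)%:R.

Lemma finitary_lcs (R : realType) n (f : R -> R) :
  finitary n (fun s s' x y => f (lcs_fun n s s' x y)).
Proof.
move=> s s' x x' y y' xx' yy'; rewrite /lcs_fun /block_lcs.
by rewrite (@block_string_ext x x') // (@block_string_ext y y').
Qed.

Lemma variance_lcs (R : realType) (d : measure_display) (T : measurableType d)
    (P : probability T R) (BX BY : nat -> {RV P >-> nat}) (sX sY : {RV P >-> bool}) l n :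
  (0 < l)%N -> block_model BX BY sX sY l ->
  ('V_P[lcs_RV BX BY sX sY n] = (model_mean l n (fun s s' x y =>
     (lcs_fun n s s' x y - model_mean l n (lcs_fun n)) ^+ 2))%:E)%E.
Proof.
move=> l0 model; rewrite /variance covariance.unlock.
have -> : 'E_P[lcs_RV BX BY sX sY n]%E = (model_mean l n (lcs_fun n))%:E.
  have fin : finitary n (lcs_fun (R := R) n) by exact: (@finitary_lcs R n id).
  have := expectation_observe l0 model fin.
  exact.
set c := model_mean _ _ _.
rewrite -(expectation_observe l0 model (@finitary_lcs R n (fun z => (z - c) ^+ 2))).
by congr ('E_P[_])%E; apply/funext => t; rewrite /= -expr2.
Qed.

Section ModelMean.
Variables (R : realType) (l n : nat).
Local Notation M := (model_mean (R := R) l n).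

Lemma model_meanE G : M G = (\sum_(s <- [:: true; false]) \sum_(s' <- [:: true; false])
  means l n (fun y => means l n (fun x => G s s' x y))) / 4%:R.
Proof.
by rewrite /model_mean /wsum !big_cons !big_nil; field.
Qed.

Let half : 2^-1 * (size [:: true; false])%:R = 1 :> R.
Proof. by rewrite mulVf // pnatr_eq0. Qed.

Lemma model_mean_ge G r :
  (forall s s', r <= means l n (fun y => means l n (fun x => G s s' x y))) -> r <= M G.
Proof.
move=> rG; rewrite -[leLHS](wsum_cst half); apply: ler_wsum => [|s _]; first by rewrite invr_ge0.
by rewrite -[leLHS](wsum_cst half); apply: ler_wsum => [|s' _ //]; rewrite invr_ge0.
Qed.

Lemma model_mean_le G r :
  (forall s s', means l n (fun y => means l n (fun x => G s s' x y)) <= r) -> M G <= r.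
Proof.
move=> rG; rewrite -[leRHS](wsum_cst half); apply: ler_wsum => [|s _]; first by rewrite invr_ge0.
by rewrite -[leRHS](wsum_cst half); apply: ler_wsum => [|s' _ //]; rewrite invr_ge0.
Qed.

(** The mean minimises the mean square deviation, so the variance may be bounded with any convenient
    centre. *)
Lemma model_mean_center G (c : R) :
  M (fun s s' x y => (G s s' x y - M G) ^+ 2) <= M (fun s s' x y => (G s s' x y - c) ^+ 2).
Proof.
have E c' : M (fun s s' x y => (G s s' x y - c') ^+ 2) =
    M (fun s s' x y => G s s' x y ^+ 2) - 2 * c' * M G + c' ^+ 2.
  by rewrite !model_meanE !big_cons !big_nil !means_sqr_expand; field.
by rewrite !E; have := sqr_ge0 (c - M G); lra.
Qed.

End ModelMean.

Theorem theorem2p1 (R : realType) :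
  exists l0 : nat, forall l : nat, (0 < l)%N -> (l0 <= l)%N ->
  exists a b : R, 0 < a /\ a < b /\
  exists n0 : nat, forall n : nat, (n0 <= n)%N ->
  forall (d : measure_display) (T : measurableType d) (P : probability T R)
         (BX BY : nat -> {RV P >-> nat}) (sX sY : {RV P >-> bool}),
    block_model BX BY sX sY l ->
    ((a * n%:R)%:E <= 'V_P[lcs_RV BX BY sX sY n])%E /\
    ('V_P[lcs_RV BX BY sX sY n] <= (b * n%:R)%:E)%E.
Proof.
exists (200 * 1000)%N => l l_gt0 l_ge.
have l1_ge1 : 1 <= l.+1%:R :> R by rewrite ler1n.
(* Below, n < 240 (p + 1) (l + 1) <= k p, so p/80 >= n/(80 k): this is the constant [a]. *)
have [k Ek k_ge1] : exists2 k : R, k = 480%:R * l.+1%:R & 1 <= k.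
  by eexists; first by []; lra.
have k_gt0 := lt_le_trans ltr01 k_ge1.
have kV_gt0 : 0 < k^-1 by rewrite invr_gt0.
have kV_le1 : k^-1 <= 1 by rewrite invf_le1.
exists (80%:R^-1 * k^-1), 38%:R; split; first by rewrite mulr_gt0 // invr_gt0.
split; first by lra.
(* This threshold makes [p] at least [241 * l + 4000], as [alignment_parameters] requires. *)
exists (240 * l.+1 * (241 * l + 4000))%N => n n_ge d T P BX BY sX sY model.
pose p := (n %/ (240 * l.+1))%N.
have K_gt0 : (0 < 240 * l.+1)%N by rewrite muln_gt0.
have p_ge : (241 * l + 4000 <= p)%N by rewrite /p leq_divRL // mulnC.
have n_ge' : (240 * p * l.+1 <= n)%N by rewrite mulnAC mulnC leq_divM.
have n_lt : (n < 240 * p.+1 * l.+1)%N by rewrite mulnAC mulnC ltn_ceil.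
have sq_le : (l.+1 ^ 2 <= n)%N.
  apply: leq_trans n_ge; rewrite expnS expn1; apply: leq_mul; [by rewrite leq_pmull | lia].
rewrite (variance_lcs n l_gt0 model) !lee_fin; split.
  apply: model_mean_ge => s s'.
  apply: le_trans (means_sqr_lower s s' _ l_ge p_ge n_ge' n_lt).
  rewrite -mulrA mulrC ler_wpM2r ?invr_ge0 ?ler0n // mulrC.
  rewrite ler_pdivrMr // Ek -!natrM ler_nat.
  by apply: leq_trans (ltnW n_lt) _; rewrite mulnA leq_mul2r; lia.
pose c : R := means l n (fun y => means l n (fun x => lcs_fun n false false x y)).
apply: le_trans (model_mean_center _ _ _ c) _.
apply: model_mean_le => s s'; have l_gt1 : (1 < l)%N by lia.
exact: means_sqr_upper.
Qed.
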